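(* Let $(G,E,\varphi)$ be a self-similar triple and let $R$ be a unital commutative $*$-ring. Suppose that for every $g\in G$ and every $v\in E^0$ there are at most finitely many minimal strongly fixed paths for $g$ with range $v$, and that $L_R(G,E)$ is simple. If $E$ contains at least one $G$-circuit, then $L_R(G,E)$ is purely infinite (simple).
   Context: A unital commutative $*$-ring $R$ is a commutative ring with $1$ together with an involution $r\mapsto r^*$. A $*$-algebra over $R$ is an (associative, not necessarily unital) $R$-algebra with a map $a\mapsto a^*$ satisfying $(a^* )^*=a$, $(ab)^*=b^*a^*$, $(ra+b)^*=r^*a^*+b^*$. A projection is $p=p^*=p^2$; a partial isometry is $s=ss^*s$. Simple means nonzero with no nontrivial proper two-sided ideals. A simple ring is purely infinite if every nonzero right ideal contains an infinite idempotent; an idempotent $p$ in a ring $A$ is infinite if there are $x,y\in A$ and an idempotent $q\neq p$ with $pq=qp=q$, $xy=p$ and $yx=q$. A directed graph $E=(E^0,E^1,r,s)$ has countable vertex set $E^0$, countable edge set $E^1$ and maps $r,s\colon E^1\to E^0$. It is row-finite if $vE^1:=r^{-1}(v)$ is finite for all $v$, and has no sources if $vE^1\neq\emptyset$ for all $v$. An action of a group $G$ on $E$ is a homomorphism from $G$ to the group of bijections of $E^0\sqcup E^1$ that preserve $E^0$ and $E^1$ and commute with $r$ and $s$. A self-similar triple $(G,E,\varphi)$: a countable discrete group $G$ (unit $e_G$), a row-finite graph $E$ with no sources, an action of $G$ on $E$, and a map $\varphi\colon G\times E^1\to G$ with $\varphi(gh,e)=\varphi(g,h\cdot e)\varphi(h,e)$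 and $\varphi(g,e)\cdot v=g\cdot v$ for all $g,h\in G$, $e\in E^1$, $v\in E^0$. An $E$-family in a $*$-algebra: mutually orthogonal projections $P_v$ ($v\in E^0$) and partial isometries $S_e$ ($e\in E^1$) with $S_e^*S_f=\delta_{e,f}P_{s(e)}$ and $P_v=\sum_{e\in vE^1}S_eS_e^*$. A $(G,E)$-family: elements $P_{v,f}$, $S_{e,g}$ ($v\in E^0$, $e\in E^1$, $f,g\in G$) such that (a) $\{P_{v,e_G}\}\cup\{S_{e,e_G}\}$ is an $E$-family; (b) $(P_{v,f})^*=P_{f^{-1}\cdot v,f^{-1}}$; (c) $P_{v,f}P_{w,h}=\delta_{v,f\cdot w}P_{v,fh}$; (d) $P_{v,f}S_{e,g}=\delta_{v,r(f\cdot e)}S_{f\cdot e,\varphi(f,e)g}$; (e) $S_{e,g}P_{v,f}=\delta_{g\cdot v,s(e)}S_{e,gf}$. $L_R(G,E)$ is the universal $*$-algebra over $R$ generated by a $(G,E)$-family $\{p_{v,f},s_{e,g}\}$. Paths are $\alpha=\alpha_1\cdots\alpha_n$ with $\alpha_i\in E^1$, $s(\alpha_i)=r(\alpha_{i+1})$, $r(\alpha)=r(\alpha_1)$, $s(\alpha)=s(\alpha_n)$; vertices are paths of length $0$; $E^*$ is the set of finite paths. The action and cocycle extend to $E^*$ by $\varphi(g,v)=g$ for $v\in E^0$, $g\cdot(\alpha e)=(g\cdot\alpha)(\varphi(g,\alpha)\cdot e)$, $\varphi(g,\alpha e)=\varphi(\varphi(g,\alpha),e)$. A path $\alpha\in E^*$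 is strongly fixed by $g$ if $g\cdot\alpha=\alpha$ and $\varphi(g,\alpha)=e_G$; it is a minimal strongly fixed path for $g$ if moreover no proper prefix of $\alpha$ is strongly fixed by $g$. A $G$-circuit is a pair $(g,\gamma)$ with $g\in G$ and $\gamma\in E^*$ of length $\ge1$ with $s(\gamma)=g\cdot r(\gamma)$. *)

(* Defs.v *)
From HB Require Import structures.
From mathcomp Require Import all_boot all_order all_algebra.
From mathcomp Require Import boolp classical_sets functions cardinality fsbigop.

Set Implicit Arguments.
Unset Strict Implicit.
Unset Printing Implicit Defensive.

Import GRing.Theory.
Local Open Scope classical_set_scope.
Local Open Scope ring_scope.

HB.mixin Record ComPzRing_hasStar R of GRing.ComPzRing R := {
  rstar : R -> R;
  rstarK : involutive rstar;
  rstarD : {morph rstar : x y / x + y};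
  rstarM : {morph rstar : x y / x * y};
}.

#[short(type="comStarRingType")]
HB.structure Definition ComStarRing :=
  {R of ComPzRing_hasStar R & GRing.ComPzRing R}.

(* L_R(G,E) need not have a unit, and MathComp's ring structures all do. *)
HB.mixin Record Zmodule_isRng A of GRing.Zmodule A := {
  rngmul : A -> A -> A;
  rngmulA : associative rngmul;
  rngmulDl : left_distributive rngmul +%R;
  rngmulDr : right_distributive rngmul +%R;
}.

#[short(type="rngType")]
HB.structure Definition Rng := {A of Zmodule_isRng A & GRing.Zmodule A}.

Reserved Notation "x ** y" (at level 40, left associativity).
Notation "x ** y" := (rngmul x y) : ring_scope.

HB.mixin Record Lmodule_Rng_isStarAlgebra (R : comStarRingType) A
    of GRing.Lmodule R A & Rng A := {
  scale_rngmulAl : forall (k : R) (a b : A), k *: (a ** b) = (k *: a) ** b;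
  scale_rngmulAr : forall (k : R) (a b : A), k *: (a ** b) = a ** (k *: b);
  star : A -> A;
  starK : involutive star;
  starM : forall a b : A, star (a ** b) = star b ** star a;
  starP : forall (k : R) (a b : A),
    star (k *: a + b) = rstar k *: star a + star b;
}.

#[short(type="starAlgType")]
HB.structure Definition StarAlgebra (R : comStarRingType) :=
  {A of Lmodule_Rng_isStarAlgebra R A & GRing.Lmodule R A & Rng A}.

Definition star_hom (R : comStarRingType) (A B : starAlgType R) (h : A -> B) :=
  [/\ linear h, {morph h : a b / a ** b} & {morph h : a / star a}].

Definition projection (R : comStarRingType) (A : starAlgType R) (p : A) :=
  p = star p /\ p = p ** p.

Definition partial_isometry (R : comStarRingType) (A : starAlgType R) (s : A) :=
  s = s ** star s ** s.

(* Ideals are ideals of the underlying ring: they are not assumed to be stable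
   under the scalars. *)
Section RingNotions.
Variable A : rngType.

Definition right_ideal (I : set A) :=
  [/\ I 0, forall a b, I a -> I b -> I (a - b)
    & forall a b, I a -> I (a ** b)].

Definition two_sided_ideal (I : set A) :=
  right_ideal I /\ forall a b, I b -> I (a ** b).

Definition simple_ring :=
  (exists a : A, a != 0) /\
  forall I : set A, two_sided_ideal I -> I = [set 0] \/ I = setT.

Definition idempotent_elt (p : A) := p ** p = p.

Definition infinite_idempotent (p : A) :=
  idempotent_elt p /\
  exists x y q : A, [/\ idempotent_elt q, q <> p,
    p ** q = q /\ q ** p = q, x ** y = p & y ** x = q].

Definition purely_infinite_simple :=
  simple_ring /\
  forall I : set A, right_ideal I -> I <> [set 0] ->
    exists2 p, I p & infinite_idempotent p.

End RingNotions.

Record digraph := Digraph {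
  vertex : choiceType;
  edge : choiceType;
  rng : edge -> vertex;
  src : edge -> vertex;
  vertex_countable : countable [set: vertex];
  edge_countable : countable [set: edge];
}.

Definition edges_to (E : digraph) (v : vertex E) : set (edge E) :=
  [set e | rng e = v].

Definition row_finite (E : digraph) :=
  forall v : vertex E, finite_set (edges_to v).

Definition no_sources (E : digraph) :=
  forall v : vertex E, edges_to v !=set0.

(* The two maps vact g and eact g form the bijection of the disjoint union of
   vertices and edges given by g; its inverse is given by g^-1. *)
Record graph_action (G : groupType) (E : digraph) := GraphAction {
  vact : G -> vertex E -> vertex E;
  eact : G -> edge E -> edge E;
  vact1 : forall v, vact 1%g v = v;
  vactM : forall g h v, vact (g * h)%g v = vact g (vact h v);
  eact1 : forall e, eact 1%g e = e;
  eactM : forall g h e, eact (g * h)%g e = eact g (eact h e);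
  rng_eact : forall g e, rng (eact g e) = vact g (rng e);
  src_eact : forall g e, src (eact g e) = vact g (src e);
}.

Record self_similar_triple (G : groupType) (E : digraph) := SelfSimilarTriple {
  sst_group_countable : countable [set: G];
  sst_row_finite : row_finite E;
  sst_no_sources : no_sources E;
  sst_action :> graph_action G E;
  coc : G -> edge E -> G;
  cocM : forall g h e, coc (g * h)%g e = (coc g (eact sst_action h e) * coc h e)%g;
  vact_coc : forall g e v, vact sst_action (coc g e) v = vact sst_action g v;
}.

(* The path alpha_1 ... alpha_n is encoded as (r(alpha_1), [:: alpha_1; ...;
   alpha_n]), and the vertex v, as a path of length 0, as (v, [::]). *)
Definition prepath (E : digraph) : Type := vertex E * seq (edge E).

Definition is_path (E : digraph) (a : prepath E) : bool :=
  sorted (fun e f => src e == rng f) a.2 &&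
  (if a.2 is e :: _ then rng e == a.1 else true).

Definition path_src (E : digraph) (a : prepath E) : vertex E :=
  last a.1 (map (@src E) a.2).

Section PathAction.
Variables (G : groupType) (E : digraph) (X : self_similar_triple G E).

Definition path_coc (g : G) (a : prepath E) : G := foldl (@coc G E X) g a.2.

Fixpoint edges_act (g : G) (l : seq (edge E)) : seq (edge E) :=
  if l is e :: l' then eact X g e :: edges_act (coc X g e) l' else [::].

Definition path_act (g : G) (a : prepath E) : prepath E :=
  (vact X g a.1, edges_act g a.2).

(* The extensions to paths are defined in the literature by right recursion, on
   the last edge; these lemmas recover that form. *)
Lemma path_act_rcons g v l e : path_act g (v, rcons l e) =
  ((path_act g (v, l)).1,
   rcons (path_act g (v, l)).2 (eact X (path_coc g (v, l)) e)).
Proof.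
rewrite /path_act /path_coc /=; congr pair.
by elim: l g => //= f l IHl g; rewrite IHl.
Qed.

Lemma path_coc_rcons g v l e :
  path_coc g (v, rcons l e) = coc X (path_coc g (v, l)) e.
Proof. by rewrite /path_coc /= foldl_rcons. Qed.

Definition strongly_fixed (g : G) (a : prepath E) :=
  path_act g a = a /\ path_coc g a = 1%g.

(* The proper prefixes of a path include its range vertex. *)
Definition minimal_strongly_fixed (g : G) (a : prepath E) :=
  [/\ is_path a, strongly_fixed g a &
      forall l, prefix l a.2 -> l != a.2 -> ~ strongly_fixed g (a.1, l)].

Definition G_circuit (g : G) (c : prepath E) :=
  [/\ is_path c, (1 <= size c.2)%N & path_src c = vact X g c.1].

End PathAction.

Section Families.
Variables (R : comStarRingType) (G : groupType) (E : digraph).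
Variable X : self_similar_triple G E.

(* Sums over a set are 0 when the support is infinite, which row-finiteness
   excludes in E_family_sum. *)
Record E_family (A : starAlgType R) (P : vertex E -> A) (S : edge E -> A) :
    Prop := EFamily {
  E_family_projection : forall v, projection (P v);
  E_family_orthogonal : forall v w, v != w -> P v ** P w = 0;
  E_family_isometry : forall e, partial_isometry (S e);
  E_family_starM : forall e f,
    star (S e) ** S f = if e == f then P (src e) else 0;
  E_family_sum : forall v, P v = \sum_(e \in edges_to v) (S e ** star (S e));
}.

Record GE_family (A : starAlgType R) (P : vertex E -> G -> A)
    (S : edge E -> G -> A) : Prop := GEFamily {
  GE_family_E : E_family (P^~ 1%g) (S^~ 1%g);
  GE_family_star : forall v f, star (P v f) = P (vact X f^-1%g v) f^-1%g;
  GE_family_PP : forall v f w h,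
    P v f ** P w h = if v == vact X f w then P v (f * h)%g else 0;
  GE_family_PS : forall v f e g,
    P v f ** S e g =
      if v == rng (eact X f e) then S (eact X f e) (coc X f e * g)%g else 0;
  GE_family_SP : forall e g v f,
    S e g ** P v f = if vact X g v == src e then S e (g * f)%g else 0;
}.

(* L, with its family (p, s), is L_R(G,E). *)
Definition is_universal_GE_algebra (L : starAlgType R) (p : vertex E -> G -> L)
    (s : edge E -> G -> L) :=
  GE_family p s /\
  forall (B : starAlgType R) (P : vertex E -> G -> B) (S : edge E -> G -> B),
    GE_family P S ->
    exists! h : L -> B, [/\ star_hom h, forall v f, h (p v f) = P v f
                          & forall e g, h (s e g) = S e g].

End Families.

(* Existence of the universal algebra: formal *-algebra expressions in the
   generators, modulo equality of their values in every (G,E)-family. *)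
Module UniversalAlgebra.
Local Open Scope quotient_scope.

Section Existence.
Variables (R : comStarRingType) (G : groupType) (E : digraph).
Variable X : self_similar_triple G E.

Inductive term :=
| TP of vertex E & G | TS of edge E & G | T0 | TAdd of term & term
| TOpp of term | TScale of R & term | TMul of term & term | TStar of term.

HB.instance Definition _ := gen_eqMixin term.
HB.instance Definition _ := gen_choiceMixin term.

Fixpoint eval (B : starAlgType R) (P : vertex E -> G -> B) (S : edge E -> G -> B)
    (t : term) : B :=
  match t with
  | TP v g => P v g | TS e g => S e g | T0 => 0
  | TAdd t u => eval P S t + eval P S u | TOpp t => - eval P S t
  | TScale k t => k *: eval P S t | TMul t u => eval P S t ** eval P S u
  | TStar t => star (eval P S t)
  end.

Definition term_rel (t u : term) : bool :=
  `[< forall (B : starAlgType R) P S, @GE_family R G E X B P S ->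
      eval P S t = eval P S u >].

Lemma term_rel_equiv : equiv_class_of term_rel.
Proof.
split.
- by move=> t; apply/asboolP.
- by move=> t u; apply/asboolP/asboolP => h B P S F; rewrite h.
- by move=> u t v /asboolP h /asboolP k; apply/asboolP => B P S F; rewrite h ?k.
Qed.
Canonical term_equiv := EquivRelPack term_rel_equiv.
Definition LGE := {eq_quot term_equiv}.
HB.instance Definition _ := Choice.on LGE.

Definition ev (B : starAlgType R) (P : vertex E -> G -> B) S (x : LGE) : B :=
  eval P S (repr x).

Lemma ev_pi (B : starAlgType R) P S t : @GE_family R G E X B P S ->
  ev P S (\pi_LGE t) = eval P S t.
Proof.
move=> F; rewrite /ev.
have /eqmodP/asboolP : repr (\pi_LGE t) = t %[mod LGE] by rewrite reprK.
exact.
Qed.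

Lemma ev_inj (x y : LGE) :
  (forall (B : starAlgType R) P S, @GE_family R G E X B P S ->
    ev P S x = ev P S y) -> x = y.
Proof.
move=> h; rewrite -[x]reprK -[y]reprK; apply/eqmodP/asboolP; exact: h.
Qed.

Definition l0 : LGE := \pi_LGE T0.
Definition ladd (x y : LGE) : LGE := \pi_LGE (TAdd (repr x) (repr y)).
Definition lopp (x : LGE) : LGE := \pi_LGE (TOpp (repr x)).
Definition lscale k (x : LGE) : LGE := \pi_LGE (TScale k (repr x)).
Definition lmul (x y : LGE) : LGE := \pi_LGE (TMul (repr x) (repr y)).
Definition lstar (x : LGE) : LGE := \pi_LGE (TStar (repr x)).
Definition lP v g : LGE := \pi_LGE (TP v g).
Definition lS e g : LGE := \pi_LGE (TS e g).

Section Ev.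
Variables (B : starAlgType R) (P : vertex E -> G -> B) (S : edge E -> G -> B).
Hypothesis F : GE_family X P S.
Lemma ev0 : ev P S l0 = 0. Proof. exact: ev_pi. Qed.
Lemma evD x y : ev P S (ladd x y) = ev P S x + ev P S y. Proof. exact: ev_pi. Qed.
Lemma evN x : ev P S (lopp x) = - ev P S x. Proof. exact: ev_pi. Qed.
Lemma evZ k x : ev P S (lscale k x) = k *: ev P S x. Proof. exact: ev_pi. Qed.
Lemma evM x y : ev P S (lmul x y) = ev P S x ** ev P S y. Proof. exact: ev_pi. Qed.
Lemma evS x : ev P S (lstar x) = star (ev P S x). Proof. exact: ev_pi. Qed.
Lemma evP v g : ev P S (lP v g) = P v g. Proof. exact: ev_pi. Qed.
Lemma evSS v g : ev P S (lS v g) = S v g. Proof. exact: ev_pi. Qed.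
Definition evE := (ev0, evD, evN, evZ, evM, evS, evP, evSS).
End Ev.

Local Ltac go := let F := fresh "F" in
  hnf; intros; apply: ev_inj; intros ? ? ? F; by rewrite !(evE F)
  ?(addrA, addrN, addNr, add0r, scalerA, scale1r, scalerDr, scalerDl,
    rngmulA, rngmulDl, rngmulDr, starK, starM, starP,
    scale_rngmulAl, scale_rngmulAr).

Fact laddA : associative ladd. Proof. go. Qed.
Fact laddC : commutative ladd.
Proof. by move=> x y; apply: ev_inj => B P S F; rewrite !(evE F) addrC. Qed.
Fact ladd0l : left_id l0 ladd. Proof. go. Qed.
Fact laddNl : left_inverse l0 lopp ladd. Proof. go. Qed.
HB.instance Definition _ := GRing.isZmodule.Build LGE laddA laddC ladd0l laddNl.
Fact lscaleA a b v : lscale a (lscale b v) = lscale (a * b) v. Proof. go. Qed.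
Fact lscale1 : left_id 1 lscale. Proof. go. Qed.
Fact lscaleDr : right_distributive lscale +%R. Proof. go. Qed.
Fact lscaleDl v : {morph lscale^~ v : a b / a + b}. Proof. go. Qed.
HB.instance Definition _ := GRing.Zmodule_isLmodule.Build R LGE lscaleA lscale1 lscaleDr lscaleDl.
Fact lmulA : associative lmul. Proof. go. Qed.
Fact lmulDl : left_distributive lmul +%R. Proof. go. Qed.
Fact lmulDr : right_distributive lmul +%R. Proof. go. Qed.
HB.instance Definition _ := Zmodule_isRng.Build LGE lmulA lmulDl lmulDr.
Fact lscaleAl (k : R) (a b : LGE) : k *: (a ** b) = (k *: a) ** b. Proof. go. Qed.
Fact lscaleAr (k : R) (a b : LGE) : k *: (a ** b) = a ** (k *: b).
Proof. by apply: ev_inj => B P S F; rewrite !(evE F) scale_rngmulAr. Qed.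
Fact lstarK : involutive lstar. Proof. go. Qed.
Fact lstarM (a b : LGE) : lstar (a ** b) = lstar b ** lstar a. Proof. go. Qed.
Fact lstarP (k : R) (a b : LGE) : lstar (k *: a + b) = rstar k *: lstar a + lstar b.
Proof. go. Qed.
HB.instance Definition _ := Lmodule_Rng_isStarAlgebra.Build R LGE lscaleAl lscaleAr lstarK lstarM lstarP.

Lemma family_LGE : GE_family X (lP : _ -> _ -> LGE) (lS : _ -> _ -> LGE).
Proof.
split; [split|..].
- by move=> v; split; apply: ev_inj => B P S F; rewrite !(evE F);
  case: (E_family_projection (GE_family_E F) v).
- move=> v w vw; apply: ev_inj => B P S F; rewrite !(evE F).
  exact: (E_family_orthogonal (GE_family_E F)).
- move=> e; apply: ev_inj => B P S F; rewrite !(evE F).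
  exact: (E_family_isometry (GE_family_E F)).
- move=> e f; apply: ev_inj => B P S F; rewrite (fun_if (ev P S)) !(evE F).
  exact: (E_family_starM (GE_family_E F)).
- move=> v; apply: ev_inj => B P S F; rewrite !(evE F).
  rewrite [LHS](E_family_sum (GE_family_E F)).
  have fv := sst_row_finite X v.
  rewrite !fsbig_finite// (big_morph _ (evD F) (ev0 F)).
  by apply: eq_bigr => e _; rewrite !(evE F).
- move=> v f; apply: ev_inj => B P S F; rewrite !(evE F); exact: (GE_family_star F).
- move=> v f w h; apply: ev_inj => B P S F; rewrite (fun_if (ev P S)) !(evE F).
  exact: (GE_family_PP F).
- move=> v f w h; apply: ev_inj => B P S F; rewrite (fun_if (ev P S)) !(evE F).
  exact: (GE_family_PS F).
- move=> v f w h; apply: ev_inj => B P S F; rewrite (fun_if (ev P S)) !(evE F).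
  exact: (GE_family_SP F).
Qed.

Lemma universal_LGE : is_universal_GE_algebra X (lP : _ -> _ -> LGE) (lS : _ -> _ -> LGE).
Proof.
split; first exact: family_LGE.
move=> B P S F; exists (ev P S); split.
  split; first split.
  - by move=> k x y; rewrite (evD F) (evZ F).
  - by move=> x y; rewrite (evM F).
  - by move=> x; rewrite (evS F).
  - by move=> v g; rewrite (evP F).
  - by move=> v g; rewrite (evSS F).
move=> h [[hlin hM hS] hPv hSe]; apply/funext => x.
have hD a b : h (a + b) = h a + h b by rewrite -[a]scale1r hlin !scale1r.
have h0 : h 0 = 0 by apply: (addrI (h 0)); rewrite -hD !addr0.
have hZ k a : h (k *: a) = k *: h a by rewrite -[k *: a]addr0 hlin h0 addr0.
have hN a : h (- a) = - h a by apply: (addrI (h a)); rewrite -hD !subrr.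
rewrite -[x]reprK (ev_pi _ F); elim: (repr x) => /=.
- by move=> v g; rewrite -hPv.
- by move=> v g; rewrite -hSe.
- by rewrite -h0.
- move=> t -> u ->; rewrite -hD; congr h; apply: ev_inj => C P' S' F'.
  by rewrite !(evE F') !(ev_pi _ F').
- move=> t ->; rewrite -hN; congr h; apply: ev_inj => C P' S' F'.
  by rewrite !(evE F') !(ev_pi _ F').
- move=> k t ->; rewrite -hZ; congr h; apply: ev_inj => C P' S' F'.
  by rewrite !(evE F') !(ev_pi _ F').
- move=> t -> u ->; rewrite -hM; congr h; apply: ev_inj => C P' S' F'.
  by rewrite !(evE F') !(ev_pi _ F').
- move=> t ->; rewrite -hS; congr h; apply: ev_inj => C P' S' F'.
  by rewrite !(evE F') !(ev_pi _ F').
Qed.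
End Existence.
End UniversalAlgebra.

Theorem universal_GE_algebra_exists (R : comStarRingType) (G : groupType)
    (E : digraph) (X : self_similar_triple G E) :
  exists (L : starAlgType R) (p : vertex E -> G -> L) (s : edge E -> G -> L),
    is_universal_GE_algebra X p s.
Proof. by do 3 eexists; exact: UniversalAlgebra.universal_LGE. Qed.

(* Main.v *)
Require Import Defs.
From HB Require Import structures.
From mathcomp Require Import all_boot all_order all_algebra.
From mathcomp Require Import boolp classical_sets functions cardinality fsbigop.
From mathcomp Require Import finmap.

(* L_R(G,E) acts on the functions on infinite paths, and also on the functions
   on germs: infinite paths decorated with the eventual values of the cocycle and
   with a degree. As the algebra is simple, both representations are faithful, so
   two products of generators that act in the same way on paths act in the same
   way on germs. With the finiteness of minimal strongly fixed paths, this lets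
   one compress any nonzero element a to a multiple of a vertex projection: choose
   a germ at which a is nonzero, and move to a nearby path that is not fixed by
   the terms of a that do not fix the germ. By simplicity again the scalar can be
   divided out, so x a y = p_u for some x, y and u.
   A G-circuit (g,c) with range v gives t = s_c p_{s(c),g} with t^* t = p_v and
   t t^* <> p_v, as otherwise t would act on paths as p_v does, while it shifts
   degrees; hence p_v is infinite. Faithfulness on the paths whose vertices all
   reach the orbit of v shows that every vertex does, so p_v = x a y for some x
   and y, and the idempotent a y p_v x of a L is equivalent to p_v. *)

Set Implicit Arguments.
Unset Strict Implicit.
Unset Printing Implicit Defensive.

Import GRing.Theory.
Local Open Scope classical_set_scope.

(** * Systems and words in the generators *)

Section Systems.
Variables (G : groupType) (E : digraph) (X : self_similar_triple G E).

(* A set on which the triple acts the way it acts on infinite paths: each point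
   has a range, a first edge and a tail. Every system Y yields a representation
   of L_R(G,E) on the functions from Y to R. *)
Record system := System {
  pt :> Type;
  base : pt -> vertex E;
  act : G -> pt -> pt;
  hd : pt -> edge E;
  tl : pt -> pt;
  act1 : forall y, act 1%g y = y;
  actM : forall g h y, act (g * h)%g y = act g (act h y);
  rng_hd : forall y, rng (hd y) = base y;
  src_hd : forall y, src (hd y) = base (tl y);
  hd_tl_inj : forall y z, hd y = hd z -> tl y = tl z -> y = z;
  prepend : forall e y, src e = base y -> exists z, hd z = e /\ tl z = y;
  hd_act : forall g y, hd (act g y) = eact X g (hd y);
  tl_act : forall g y, tl (act g y) = act (coc X g (hd y)) (tl y)
}.

Lemma coc1 e : coc X 1%g e = 1%g.
Proof.
have := cocM X 1%g 1%g e; rewrite mulg1 eact1 => h.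
by apply: (mulgI (coc X 1%g e)); rewrite -h mulg1.
Qed.

Lemma coc_vactK g e :
  (coc X g^-1%g (eact X g e))^-1%g = coc X g e.
Proof.
apply: (mulgI (coc X g^-1%g (eact X g e))).
by rewrite -cocM mulVg coc1 mulgV.
Qed.

Section Points.
Variable Y : system.
Implicit Types y z : Y.

Lemma actK g : cancel (@act Y g) (act g^-1%g).
Proof. by move=> y; rewrite -actM mulVg act1. Qed.

Lemma actVK g : cancel (@act Y g^-1%g) (act g).
Proof. by move=> y; rewrite -actM mulgV act1. Qed.

Lemma base_act g y : base (act g y) = vact X g (base y).
Proof. by rewrite -!rng_hd hd_act rng_eact. Qed.

Definition cons e y : Y :=
  if pselect (src e = base y) is left h then projT1 (cid (prepend h)) else y.

Lemma hd_cons e y : src e = base y -> hd (cons e y) = e.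
Proof.
by move=> h; rewrite /cons; case: pselect => // h'; case: cid => z [].
Qed.

Lemma tl_cons e y : src e = base y -> tl (cons e y) = y.
Proof.
by move=> h; rewrite /cons; case: pselect => // h'; case: cid => z [].
Qed.

Lemma base_cons e y : src e = base y -> base (cons e y) = rng e.
Proof. by move=> h; rewrite -rng_hd hd_cons. Qed.

Lemma consE y : cons (hd y) (tl y) = y.
Proof.
by have h := src_hd y; apply: hd_tl_inj; rewrite ?hd_cons ?tl_cons.
Qed.

(** This is $\varphi(g,y_1\cdots y_n)$ for the first [n] edges of [y]. *)
Fixpoint pcoc n g y := if n is n'.+1 then pcoc n' (coc X g (hd y)) (tl y) else g.

Fixpoint tln n y : Y := if n is n'.+1 then tln n' (tl y) else y.

Lemma tlnD m n y : tln (m + n) y = tln m (tln n y).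
Proof. by elim: n y => [|n IH] y; rewrite ?addn0 // addnS /= IH. Qed.

Lemma tln_act n g y : tln n (act g y) = act (pcoc n g y) (tln n y).
Proof. by elim: n g y => //= n IH g y; rewrite tl_act IH. Qed.

Lemma pcocM n g h y : pcoc n (g * h)%g y = (pcoc n g (act h y) * pcoc n h y)%g.
Proof. by elim: n g h y => //= n IH g h y; rewrite cocM IH hd_act tl_act. Qed.

Lemma pcoc1 n y : pcoc n 1%g y = 1%g.
Proof. by elim: n y => //= n IH y; rewrite coc1. Qed.

Fixpoint prefix_of n y := if n is n'.+1 then hd y :: prefix_of n' (tl y) else [::].

End Points.

(** Length 0 still compares ranges, since a path of length 0 is a vertex. The points may lie in
    different systems, so a germ can be compared with a path. *)
Fixpoint agree (Y Z : system) n (y : Y) (z : Z) : Prop :=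
  if n is n'.+1 then hd y = hd z /\ agree n' (tl y) (tl z) else base y = base z.

Lemma agree_base (Y Z : system) n (y : Y) (z : Z) : agree n y z -> base y = base z.
Proof. by case: n => //= n [h _]; rewrite -!rng_hd h. Qed.

Lemma agree_refl (Y : system) n (y : Y) : agree n y y.
Proof. by elim: n y => //=. Qed.

Lemma agree_sym (Y Z : system) n (y : Y) (z : Z) : agree n y z -> agree n z y.
Proof. by elim: n y z => //= n IH y z [-> /IH]. Qed.

Lemma agree_trans (Y Z W : system) n (y : Y) (z : Z) (w : W) :
  agree n y z -> agree n z w -> agree n y w.
Proof.
elim: n y z w => [|n IH] y z w /=; first by move=> ->.
by move=> [-> /IH h] [-> /h].
Qed.

Lemma agreeD (Y Z : system) m n (y : Y) (z : Z) :
  agree (m + n) y z <-> agree m y z /\ agree n (tln m y) (tln m z).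
Proof.
elim: m y z => [|m IH] y z /=.
  by rewrite add0n; split=> [h|[]//]; split=> //; exact: agree_base h.
by rewrite IH; split=> [[? []]|[[]]].
Qed.

Lemma agree_le (Y Z : system) m n (y : Y) (z : Z) :
  (m <= n)%N -> agree n y z -> agree m y z.
Proof. by move=> /subnKC <- /agreeD[]. Qed.

Lemma agree_pcoc (Y Z : system) n g (y : Y) (z : Z) :
  agree n y z -> pcoc n g y = pcoc n g z.
Proof. by elim: n g y z => //= n IH g y z [-> /IH]. Qed.

Lemma agree_act (Y Z : system) n g (y : Y) (z : Z) :
  agree n y z -> agree n (act g y) (act g z).
Proof.
elim: n g y z => [|n IH] g y z /=; first by rewrite !base_act => ->.
by move=> [h /IH h']; rewrite !hd_act !tl_act h.
Qed.

Lemma agree_tln_inj (Y : system) n (y z : Y) :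
  agree n y z -> tln n y = tln n z -> y = z.
Proof.
elim: n y z => //= n IH y z [h k] h'.
by apply: hd_tl_inj => //; exact: IH.
Qed.

Lemma agree_concat (Y Z : system) n (y : Y) (z : Z) : base z = base (tln n y) ->
  exists x : Z, agree n x y /\ tln n x = z.
Proof.
elim: n y z => [|n IH] y z; first by exists z.
move=> /IH[x [xy <-]].
have h : src (hd y) = base x by rewrite src_hd (agree_base xy).
by exists (cons (hd y) x); rewrite /= hd_cons // tl_cons.
Qed.

Lemma prefix_of_agree (Y Z : system) n (y : Y) (z : Z) :
  base y = base z -> prefix_of n y = prefix_of n z -> agree n y z.
Proof.
elim: n y z => //= n IH y z _ [h /IH k]; split=> //.
by apply: k; rewrite -!src_hd h.
Qed.

Lemma agree_prefix_of (Y Z : system) n (y : Y) (z : Z) :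
  agree n y z -> prefix_of n y = prefix_of n z.
Proof. by elim: n y z => //= n IH y z [-> /IH ->]. Qed.

(** * Words in the generators as partial bijections *)

Inductive word :=
| WP of vertex E & G | WS of edge E | WSt of edge E | WM of word & word.

Fixpoint wstar w :=
  match w with
  | WP v g => WP (vact X g^-1%g v) g^-1%g
  | WS e => WSt e | WSt e => WS e | WM a b => WM (wstar b) (wstar a)
  end.

(* Words act on functions on a system by composition with partial maps: for a
   word w, (w x)(y) = x(wact w y), and 0 where wact w y is undefined. *)
Fixpoint wact (Y : system) w (y : Y) : option Y :=
  match w with
  | WP v g => if base y == v then Some (act g^-1%g y) else None
  | WS e => if hd y == e then Some (tl y) else None
  | WSt e => if base y == src e then Some (cons e y) else None
  | WM a b => obind (@wact Y b) (wact a y)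
  end.

Lemma wstarK (Y : system) w (y : Y) : wact (wstar (wstar w)) y = wact w y.
Proof.
elim: w y => //= [v g|a IHa b IHb] y.
  by rewrite -vactM invgK mulgV vact1.
by rewrite IHa; case: (wact a y) => //= z; rewrite IHb.
Qed.

(** Each generator acts as a partial injection whose inverse is the action of its adjoint, and this
    passes to products. *)
Lemma wact_star (Y : system) w (y z : Y) :
  wact w y = Some z -> wact (wstar w) z = Some y.
Proof.
elim: w y z => /= [v g|e|e|a IHa b IHb] y z.
- case: eqP => // <- [<-]; rewrite base_act eqxx; congr Some.
  by rewrite -actM invgK mulgV act1.
- by case: eqP => // <- [<-]; rewrite src_hd eqxx consE.
- by case: eqP => // h [<-]; rewrite hd_cons // eqxx tl_cons.
- by case h : (wact a y) => [x|] //= /IHb -> /=; exact: IHa.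
Qed.

Lemma wact_starE (Y : system) w (y z : Y) :
  wact (wstar w) z = Some y <-> wact w y = Some z.
Proof.
by split=> [/wact_star|]; [rewrite wstarK | exact: wact_star].
Qed.

Lemma wact_starN (Y : system) w (z : Y) :
  (forall y, wact w y <> Some z) -> wact (wstar w) z = None.
Proof. by case h : wact => [y|] //; move: h => /wact_starE h /(_ y). Qed.

(** This word is $S_{y_1}\cdots S_{y_n}P_{s(y_n)}$; the trailing projection gives the case $n=0$ a
    meaning. *)
Fixpoint wpath (Y : system) n (y : Y) :=
  if n is n'.+1 then WM (WS (hd y)) (wpath n' (tl y)) else WP (base y) 1%g.

Lemma wact_path (Y Z : system) n (y : Y) (z : Z) :
  wact (wpath n y) z = if pselect (agree n z y) then Some (tln n z) else None.
Proof.
elim: n y z => [|n IH] y z /=.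
  by rewrite invg1 act1; case: eqP; case: pselect.
case: eqP => [h|h] /=.
  by rewrite IH ; case: pselect => h'; case: pselect => // -[].
by case: pselect => // -[].
Qed.

Lemma wact_path_starP (Y Z : system) n (y : Y) (z x : Z) :
  wact (wstar (wpath n y)) z = Some x <-> agree n x y /\ tln n x = z.
Proof.
rewrite wact_starE wact_path; case: pselect => h; split=> //; first by case.
- by case=> _ ->.
- by case.
Qed.

Lemma wact_path_starN (Y Z : system) n (y : Y) (z : Z) :
  wact (wstar (wpath n y)) z = None <-> base z <> base (tln n y).
Proof.
split=> [h /agree_concat[x /wact_path_starP]|h]; first by rewrite h.
case k : wact => [x|] //; case/wact_path_starP: k => k l; case: h.
have /agreeD[_ /agree_base <-] : agree (n + 0) x y by rewrite addn0.
by rewrite l.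
Qed.

(** Near a point a word removes [n] edges, acts on the tail by a fixed group element and puts [m]
    edges in front. On germs, $n-m$ is the drop in degree. *)
Lemma wact_local (Y : system) w (y z : Y) : wact w y = Some z ->
  exists n m h, forall y' : Y, agree n y' y ->
    exists z', [/\ wact w y' = Some z', agree m z' z &
                  @tln Y n y' = act h (@tln Y m z')].
Proof.
elim: w y z => /= [v g|e|e|a IHa b IHb] y z.
- case: eqP => // <- [<-]; exists 0, 0, g => y' /= k; rewrite k eqxx.
  by exists (act g^-1%g y'); split=> //=; rewrite ?base_act ?actVK // k.
- case: eqP => // <- [<-]; exists 1, 0, 1%g => y' /= [-> h]; rewrite eqxx.
  by exists (tl y'); rewrite act1.
- case: eqP => // h [<-]; exists 0, 1, 1%g => y' /= k; rewrite k h eqxx.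
  have k' : src e = base y' by rewrite k.
  exists (cons e y'); rewrite act1; split=> //=; rewrite ?hd_cons ?tl_cons //.
case h : (wact a y) => [x|] //= bx.
have [n1 [m1 [h1 P1]]] := IHa _ _ h.
have [n2 [m2 [h2 P2]]] := IHb _ _ bx.
have [x0 [E0 _ E1]] := P1 y (agree_refl _ _).
move: E0; rewrite h => -[E0]; subst x0.
have [z0 [E0 _ E2]] := P2 x (agree_refl _ _).
move: E0; rewrite bx => -[E0]; subst z0.
(* No edges are cancelled between the two words: the group element of each is pushed through the
   extra edges by the cocycle. *)
exists (n1 + n2), (m2 + m1).
exists (pcoc n2 h1 (tln m1 x) * pcoc m1 h2 (tln m2 z))%g => y' /agreeD[y1 y2].
have [x' [ax' x'x Ex']] := P1 _ y1.
rewrite ax' /=.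
have x'xt : agree n2 (tln m1 x') (tln m1 x).
  rewrite -[tln m1 x'](actK h1) -[tln m1 x](actK h1) -Ex' -E1.
  exact: agree_act.
have xx : agree (m1 + n2) x' x by apply/agreeD.
have [|z' [bz' z'z Ez']] := P2 x'; first by apply: agree_le xx; rewrite leq_addl.
have z'zt : agree m1 (tln m2 z') (tln m2 z).
  rewrite -[tln m2 z'](actK h2) -[tln m2 z](actK h2) -Ez' -E2.
  by apply: agree_act; move: xx; rewrite addnC => /agreeD[].
exists z'; split=> //; first by apply/agreeD.
rewrite addnC tlnD Ex' tln_act actM (agree_pcoc _ x'xt); congr act.
by rewrite -(agree_pcoc _ z'zt) addnC tlnD -tln_act -Ez' -!tlnD addnC.
Qed.

Lemma wact_localN (Y : system) w (y : Y) : wact w y = None ->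
  exists n, forall y' : Y, agree n y' y -> wact w y' = None.
Proof.
elim: w y => /= [v g|e|e|a IHa b IHb] y.
- by case: eqP => // h _; exists 0 => y' /= ->; case: eqP.
- by case: eqP => // h _; exists 1 => y' /= [-> _]; case: eqP.
- by case: eqP => // h _; exists 0 => y' /= ->; case: eqP.
case h : (wact a y) => [x|] /=; last first.
  by move=> _; have [n P] := IHa _ h; exists n => y' /P ->.
move=> /IHb[n2 P2]; have [n1 [m1 [h1 P1]]] := wact_local h.
have [x0 [E0 _ E1]] := P1 y (agree_refl _ _).
move: E0; rewrite h => -[E0]; subst x0.
exists (n1 + n2) => y' /agreeD[y1 y2].
have [x' [-> x'x Ex']] := P1 _ y1; apply: P2.
suff : agree (m1 + n2) x' x by apply: agree_le; rewrite leq_addl.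
apply/agreeD; split=> //.
rewrite -[tln m1 x'](actK h1) -[tln m1 x](actK h1) -Ex' -E1.
exact: agree_act.
Qed.

Lemma wact_continuous (Y : system) w (y z : Y) k : wact w y = Some z ->
  exists n, forall y' : Y, agree n y' y ->
    exists2 z', wact w y' = Some z' & agree k z' z.
Proof.
move=> wy; have [n [m [h P]]] := wact_local wy.
have [z0 [E0 _ E1]] := P y (agree_refl _ _).
move: E0; rewrite wy => -[E0]; subst z0.
exists (n + k) => y' /agreeD[y1 y2]; have [z' [-> z'z Ez']] := P _ y1.
exists z' => //.
suff : agree (m + k) z' z by apply: agree_le; rewrite leq_addl.
apply/agreeD; split=> //.
rewrite -[tln m z'](actK h) -[tln m z](actK h) -Ez' -E1.
exact: agree_act.
Qed.

End Systems.

Local Open Scope ring_scope.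

(** * The representation on a system *)

Section OperatorPairs.
Variables (R : comStarRingType) (T : Type).
Local Notation M := (T -> R).

(** The linear combination enters as any [z] equal to it pointwise, so that [lin] applies without
    function extensionality. *)
Definition lin (f : M -> M) :=
  forall k x y z, (forall u, z u = k * x u + y u) ->
    forall t, f z t = k * f x t + f y t.

(* A linear map and its formal adjoint: the second components are multiplied in
   reverse order, so exchanging the components (up to conjugation of the
   scalars) is an involution. *)
Record op_pair := OpPair { fw : M -> M; bw : M -> M; _ : lin fw; _ : lin bw }.

HB.instance Definition _ := gen_eqMixin op_pair.
HB.instance Definition _ := gen_choiceMixin op_pair.

Lemma fw_lin a : lin (fw a). Proof. by case: a. Qed.
Lemma bw_lin a : lin (bw a). Proof. by case: a. Qed.

Lemma op_pair_ext a b :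
  (forall x t, fw a x t = fw b x t) -> (forall x t, bw a x t = bw b x t) -> a = b.
Proof.
case: a b => [f f' lf lf'] [g g' lg lg'] /= h k.
have e : f = g by apply/funext => x; apply/funext => t.
have e' : f' = g' by apply/funext => x; apply/funext => t.
by subst g g'; congr OpPair; exact: Prop_irrelevance.
Qed.

Lemma linD f x y t : lin f -> f (fun u => x u + y u) t = f x t + f y t.
Proof. by move=> /(_ 1 x y) -> => [|u]; rewrite mul1r. Qed.

Lemma lin0 f t : lin f -> f (fun=> 0) t = 0.
Proof.
by move=> /(_ (- 1) (fun=> 0) (fun=> 0)) -> => [|u]; rewrite mulN1r addNr ?oppr0.
Qed.

Lemma linZ f k x t : lin f -> f (fun u => k * x u) t = k * f x t.
Proof.
move=> lf; rewrite (lf k x (fun=> 0)) ?lin0 ?addr0 // => u.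
by rewrite addr0.
Qed.

Fact lin_zero : lin (fun _ _ => 0).
Proof. by move=> k x y z _ t; rewrite mulr0 addr0. Qed.

Fact lin_add f g : lin f -> lin g -> lin (fun x t => f x t + g x t).
Proof.
by move=> lf lg k x y z h t; rewrite (lf k x y z h) (lg k x y z h) mulrDr addrACA.
Qed.

Fact lin_scale c f : lin f -> lin (fun x t => c * f x t).
Proof.
by move=> lf k x y z h t; rewrite (lf k x y z h) mulrDr !mulrA (mulrC c k).
Qed.

Fact lin_opp f : lin f -> lin (fun x t => - f x t).
Proof. by move=> lf k x y z h t; rewrite (lf k x y z h) opprD mulrN. Qed.

Fact lin_comp f g : lin f -> lin g -> lin (f \o g).
Proof. by move=> lf lg k x y z h t; apply: lf => u; exact: lg. Qed.

Definition op_zero := OpPair lin_zero lin_zero.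
Definition op_add a b :=
  OpPair (lin_add (fw_lin a) (fw_lin b)) (lin_add (bw_lin a) (bw_lin b)).
Definition op_opp a := OpPair (lin_opp (fw_lin a)) (lin_opp (bw_lin a)).
Definition op_scale k a :=
  OpPair (lin_scale k (fw_lin a)) (lin_scale k (bw_lin a)).
Definition op_mul a b :=
  OpPair (lin_comp (fw_lin a) (fw_lin b)) (lin_comp (bw_lin b) (bw_lin a)).

Fact op_addA : associative op_add.
Proof. by move=> a b c; apply: op_pair_ext => x t /=; rewrite addrA. Qed.
Fact op_addC : commutative op_add.
Proof. by move=> a b; apply: op_pair_ext => x t /=; rewrite addrC. Qed.
Fact op_add0 : left_id op_zero op_add.
Proof. by move=> a; apply: op_pair_ext => x t /=; rewrite add0r. Qed.
Fact op_addN : left_inverse op_zero op_opp op_add.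
Proof. by move=> a; apply: op_pair_ext => x t /=; rewrite addNr. Qed.
HB.instance Definition _ :=
  GRing.isZmodule.Build op_pair op_addA op_addC op_add0 op_addN.

Fact op_scaleA k l a : op_scale k (op_scale l a) = op_scale (k * l) a.
Proof. by apply: op_pair_ext => x t /=; rewrite mulrA. Qed.
Fact op_scale1 : left_id 1 op_scale.
Proof. by move=> a; apply: op_pair_ext => x t /=; rewrite mul1r. Qed.
Fact op_scaleDr : right_distributive op_scale +%R.
Proof. by move=> k a b; apply: op_pair_ext => x t /=; rewrite mulrDr. Qed.
Fact op_scaleDl a : {morph op_scale^~ a : k l / k + l}.
Proof. by move=> k l; apply: op_pair_ext => x t /=; rewrite mulrDl. Qed.
HB.instance Definition _ := GRing.Zmodule_isLmodule.Build R op_pair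
  op_scaleA op_scale1 op_scaleDr op_scaleDl.

Fact op_mulA : associative op_mul.
Proof. by move=> a b c; apply: op_pair_ext. Qed.
Fact op_mulDl : left_distributive op_mul +%R.
Proof.
by move=> a b c; apply: op_pair_ext => x t //=; rewrite (linD _ _ _ (bw_lin c)).
Qed.
Fact op_mulDr : right_distributive op_mul +%R.
Proof.
by move=> a b c; apply: op_pair_ext => x t //=; rewrite (linD _ _ _ (fw_lin a)).
Qed.
HB.instance Definition _ := Zmodule_isRng.Build op_pair op_mulA op_mulDl op_mulDr.

Lemma rstar0 : rstar 0 = 0 :> R.
Proof. by apply: (addrI (rstar 0)); rewrite -rstarD !addr0. Qed.

Definition bar (x : M) : M := fun t => rstar (x t).

Lemma barK : involutive bar.
Proof. by move=> x; apply/funext => t; rewrite /bar rstarK. Qed.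

Fact lin_bar f : lin f -> lin (bar \o f \o bar).
Proof.
move=> lf k x y z h t; rewrite /= /bar -[in RHS](rstarK k) -rstarM -rstarD.
by congr rstar; apply: lf => u; rewrite h rstarD rstarM.
Qed.

Definition op_star a := OpPair (lin_bar (bw_lin a)) (lin_bar (fw_lin a)).

Fact op_mul_scalel (k : R) (a b : op_pair) : k *: (a ** b) = (k *: a) ** b.
Proof. by apply: op_pair_ext => x t //=; rewrite (linZ _ _ _ (bw_lin b)). Qed.
Fact op_mul_scaler (k : R) (a b : op_pair) : k *: (a ** b) = a ** (k *: b).
Proof. by apply: op_pair_ext => x t //=; rewrite (linZ _ _ _ (fw_lin a)). Qed.
Fact op_starK : involutive op_star.
Proof. by move=> a; apply: op_pair_ext => x t /=; rewrite !barK. Qed.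
Fact op_starM (a b : op_pair) : op_star (a ** b) = op_star b ** op_star a.
Proof. by apply: op_pair_ext => x t /=; rewrite !barK. Qed.
Fact op_starP (k : R) (a b : op_pair) :
  op_star (k *: a + b) = rstar k *: op_star a + op_star b.
Proof.
by apply: op_pair_ext => x t; rewrite /= /bar rstarD rstarM.
Qed.
HB.instance Definition _ := Lmodule_Rng_isStarAlgebra.Build R op_pair
  op_mul_scalel op_mul_scaler op_starK op_starM op_starP.

Definition pull (f : T -> option T) : M -> M := fun x t => oapp x 0 (f t).

Fact pull_lin f : lin (pull f).
Proof.
by move=> k x y z h t; rewrite /pull; case: (f t) => //=; rewrite mulr0 addr0.
Qed.

Definition pulls f g := OpPair (pull_lin f) (pull_lin g).

Lemma pulls_mul f g f' g' :
  pulls f g ** pulls f' g' =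
  pulls (fun t => obind f' (f t)) (fun t => obind g (g' t)).
Proof.
apply: op_pair_ext => x t; rewrite /= /pull.
  by case: (f t).
by case: (g' t).
Qed.

Lemma pulls_star f g : star (pulls f g) = pulls g f.
Proof.
apply: op_pair_ext => x t; rewrite /= /bar /pull.
  by case: (g t) => /= [s|]; rewrite ?rstarK ?rstar0.
by case: (f t) => /= [s|]; rewrite ?rstarK ?rstar0.
Qed.

Lemma pulls_ext f g f' g' : f =1 f' -> g =1 g' -> pulls f g = pulls f' g'.
Proof. by move=> /funext-> /funext->. Qed.

Lemma pulls0 f g : (forall t, f t = None) -> (forall t, g t = None) ->
  pulls f g = 0.
Proof.
by move=> h k; apply: op_pair_ext => x t; rewrite /= /pull ?h ?k.
Qed.

End OperatorPairs.

Lemma fw_sum (R : comStarRingType) (T I : Type) (r : seq I)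
    (F : I -> op_pair R T) x t :
  fw (\sum_(i <- r) F i) x t = \sum_(i <- r) fw (F i) x t.
Proof. by elim/big_rec2: _ => // i a b _ <-. Qed.

Lemma bw_sum (R : comStarRingType) (T I : Type) (r : seq I)
    (F : I -> op_pair R T) x t :
  bw (\sum_(i <- r) F i) x t = \sum_(i <- r) bw (F i) x t.
Proof. by elim/big_rec2: _ => // i a b _ <-. Qed.

Section SystemRepresentation.
Variables (R : comStarRingType) (G : groupType) (E : digraph).
Variables (X : self_similar_triple G E) (Y : system X).

Definition opw (w : word G E) : op_pair R Y :=
  pulls R (wact (Y := Y) w) (wact (wstar X w)).

Lemma opwM a b : opw (WM a b) = opw a ** opw b.
Proof. by rewrite pulls_mul. Qed.

Lemma opw_star a : star (opw a) = opw (wstar X a).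
Proof.
by rewrite pulls_star; apply: pulls_ext => y; rewrite ?wstarK.
Qed.

(** A partial injection determines its inverse, so equality of the forward actions gives equality of
    the adjoint components too. *)
Lemma opw_eq a b : (forall y : Y, wact a y = wact b y) -> opw a = opw b.
Proof.
move=> h; apply: pulls_ext => // y.
case k : (wact _ y) => [z|]; case l : (wact _ y) => [t|] //.
- move/wact_starE: k; rewrite h => /wact_starE; by rewrite l.
- move/wact_starE: k; rewrite h => /wact_starE; by rewrite l.
- move/wact_starE: l; rewrite -h => /wact_starE; by rewrite k.
Qed.

Lemma opw0 a : (forall y : Y, wact a y = None) -> opw a = 0.
Proof.
move=> h; apply: pulls0 => // y; apply: wact_starN => z; by rewrite h.
Qed.

Definition repP v g : op_pair R Y := opw (WP v g).
Definition repS e g : op_pair R Y := opw (WM (WS G e) (WP (src e) g)).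

(** By [opw_eq] and [opw0] the product relations become identities of partial maps, checked point by
    point. The sum relation is not one between words and is checked on functions. *)
Lemma GE_family_rep : GE_family X repP repS.
Proof.
have S1 e : repS e 1%g = opw (WS G e).
  apply: opw_eq => y /=; case: eqP => //= h.
  by rewrite -h src_hd eqxx invg1 act1.
have SP1 e g v f :
    repS e g ** repP v f = if vact X g v == src e then repS e (g * f)%g else 0.
  rewrite -opwM; case: eqP => h.
    apply: opw_eq => y /=; case: eqP => //= k.
    rewrite -k src_hd eqxx /= base_act -src_hd k -h -vactM mulVg vact1 eqxx.
    by rewrite invgM actM.
  apply: opw0 => y /=; case: eqP => //= k; case: eqP => //= l.
  case: eqP => //= m; case: h; by rewrite -m base_act -vactM mulgV vact1 l.
have PS1 v f e g :
    repP v f ** repS e g =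
      if v == rng (eact X f e) then repS (eact X f e) (coc X f e * g)%g else 0.
  rewrite -opwM; case: eqP => h.
    apply: opw_eq => y /=; case: (hd y =P eact X f e) => [k|k] /=; last first.
      case: eqP => //= _; rewrite hd_act; case: eqP => //= l.
      by case: k; rewrite -l -eactM mulgV eact1.
    rewrite h -k rng_hd eqxx /= hd_act tl_act k -eactM mulVg eact1 eqxx /=.
    rewrite base_act -src_hd k src_eact -[coc X f^-1%g _]invgK coc_vactK.
    rewrite -(vact_coc X f e) -vactM mulVg vact1 !eqxx.
    by rewrite invgM actM.
  apply: opw0 => y /=; case: eqP => //= k; case: eqP => //= l.
  by case: h; rewrite -k -l hd_act -eactM mulgV eact1 rng_hd.
split=> //; last 2 first.
- by move=> v f; rewrite opw_star.
- move=> v f w h; rewrite -opwM; case: eqP => k.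
    apply: opw_eq => y /=; case: eqP => //= l; rewrite base_act.
    by rewrite l k -vactM mulVg vact1 eqxx invgM actM.
  apply: opw0 => y /=; case: eqP => //= l; rewrite base_act l; case: eqP => // m.
  by case: k; rewrite -m -vactM mulgV vact1.
split.
- move=> v; split.
    by rewrite opw_star; apply: opw_eq => y /=; rewrite !invg1 vact1.
  rewrite /repP -opwM; apply: opw_eq => y /=; case: eqP => //= h.
  by rewrite base_act invg1 !act1 vact1 h eqxx.
- move=> v w h; rewrite /repP -opwM; apply: opw0 => y /=; case: eqP => //= k.
  by rewrite base_act invg1 vact1 k (negbTE h).
- move=> e; rewrite S1 /partial_isometry opw_star -!opwM; apply: opw_eq => y /=.
  by case: eqP => //= h; rewrite -h src_hd eqxx /= consE eqxx.
- move=> e f; rewrite !S1 opw_star -opwM; case: eqP => [<-|h].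
    apply: opw_eq => y /=; case: eqP => //= h.
    by rewrite hd_cons // eqxx tl_cons // invg1 act1.
  by apply: opw0 => y /=; case: eqP => //= k; rewrite hd_cons //; case: eqP.
- move=> v.
  under eq_fsbigr do rewrite S1 opw_star -opwM.
  have fv := sst_row_finite X v.
  rewrite fsbig_finite //=.
  (* The only summand that can be nonzero at [y] belongs to the edge [hd y]: $S_eS_e^*$ restricts to
     the points with first edge [e]. *)
  have key (x : Y -> R) (y : Y) : pull (@wact G E X Y (WP v 1%g)) x y =
    \sum_(e <- fset_set (edges_to v)) pull (@wact G E X Y (WM (WS G e) (WSt G e))) x y.
    rewrite {1}/pull /=; case: eqP => h /=.
      rewrite invg1 act1 (bigD1_seq (hd y)) /=; last by exact: fset_uniq.
        rewrite /pull /= eqxx /= src_hd eqxx /= consE big1 ?addr0 // => e /eqP k.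
        by case: eqP => // l; case: k.
      by rewrite in_fset_set //; apply/mem_set; rewrite /edges_to /= rng_hd.
    rewrite big_seq big1 // => e; rewrite in_fset_set // => /set_mem k.
    by rewrite /pull /=; case: eqP => // l; case: h; rewrite -rng_hd l k.
  apply: op_pair_ext => x y; first by rewrite fw_sum -key.
  rewrite bw_sum -key /= /pull; congr (oapp _ _ _).
  by rewrite /= !invg1 vact1.
Qed.

End SystemRepresentation.

(** * Consequences of universality and simplicity *)

Section StarAlgebra.
Variables (R : comStarRingType) (A : starAlgType R).
Implicit Types a b : A.

Lemma rstar1 : rstar 1 = 1 :> R.
Proof. by rewrite -[LHS]mulr1 -{2}(rstarK 1) -rstarM mul1r rstarK. Qed.

Lemma starD a b : star (a + b) = star a + star b.
Proof. by rewrite -[a]scale1r starP rstar1 !scale1r. Qed.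

Lemma star0 : star (0 : A) = 0.
Proof. by apply: (addrI (star 0)); rewrite -starD !addr0. Qed.

Lemma starZ k a : star (k *: a) = rstar k *: star a.
Proof. by rewrite -[k *: a]addr0 starP star0 addr0. Qed.

Lemma rngmul0l a : 0 ** a = 0.
Proof. by apply: (addrI (0 ** a)); rewrite -rngmulDl !addr0. Qed.

Lemma rngmul0r a : a ** 0 = 0.
Proof. by apply: (addrI (a ** 0)); rewrite -rngmulDr !addr0. Qed.

Lemma rngmul_suml (I : Type) (r : seq I) (F : I -> A) b :
  (\sum_(i <- r) F i) ** b = \sum_(i <- r) F i ** b.
Proof. exact: (big_morph (rngmul^~ b) (fun x y => rngmulDl x y b) (rngmul0l b)). Qed.

Lemma rngmul_sumr (I : Type) (r : seq I) (F : I -> A) b :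
  b ** (\sum_(i <- r) F i) = \sum_(i <- r) b ** F i.
Proof. exact: (big_morph (rngmul b) (rngmulDr b) (rngmul0r b)). Qed.

Lemma star_sum (I : Type) (r : seq I) (F : I -> A) :
  star (\sum_(i <- r) F i) = \sum_(i <- r) star (F i).
Proof. exact: (big_morph _ starD star0). Qed.

End StarAlgebra.

Section Universal.
Variables (R : comStarRingType) (G : groupType) (E : digraph).
Variables (X : self_similar_triple G E) (L : starAlgType R).
Variables (p : vertex E -> G -> L) (s : edge E -> G -> L).
Hypothesis univL : is_universal_GE_algebra X p s.
Local Notation word := (word G E).

(** Universality on both sides gives homomorphisms [h] to the algebra of terms and [k] back with
    [k (h a) = a]. As [k] is evaluation, induction on a term representing [h a] applies. *)
Lemma GE_algebra_ind (D : L -> Prop) :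
  (forall v g, D (p v g)) -> (forall e g, D (s e g)) -> D 0 ->
  (forall a b, D a -> D b -> D (a + b)) -> (forall a, D a -> D (- a)) ->
  (forall k a, D a -> D (k *: a)) -> (forall a b, D a -> D b -> D (a ** b)) ->
  (forall a, D a -> D (star a)) -> forall a, D a.
Proof.
move=> Dp Ds D0 DD DN DZ DM DS a.
have [F u] := univL.
pose U := @UniversalAlgebra.universal_LGE R G E X.
have [h [[hhom hp hs] _]] := u _ _ _ U.1.
have [k [[khom kp ks] _]] := U.2 _ _ _ F.
have [i [_ iu]] := u _ _ _ F.
have -> : a = k (h a).
  have e1 : i = id by apply: iu; split.
  have e2 : i = k \o h.
    apply: iu; split=> [|v g|e g]; last 2 first.
    - by rewrite /= hp kp.
    - by rewrite /= hs ks.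
    case: hhom => h1 h2 h3; case: khom => k1 k2 k3; split.
    - by move=> c x y /=; rewrite h1 k1.
    - by move=> x y /=; rewrite h2 k2.
    - by move=> x /=; rewrite h3 k3.
  by rewrite -[LHS]/(id a) -e1 e2.
have -> : k = UniversalAlgebra.ev p s.
  have [j [_ ju]] := U.2 _ _ _ F.
  rewrite -(ju k) //; apply: ju; split.
  - split.
    + by move=> c x y; rewrite (UniversalAlgebra.evD F) (UniversalAlgebra.evZ F).
    + by move=> x y; rewrite (UniversalAlgebra.evM F).
    + by move=> x; rewrite (UniversalAlgebra.evS F).
  - by move=> v g; rewrite (UniversalAlgebra.evP F).
  - by move=> e g; rewrite (UniversalAlgebra.evSS F).
rewrite /UniversalAlgebra.ev; elim: (generic_quotient.repr _) => //=; auto.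
Qed.

Fixpoint wval (w : word) : L :=
  match w with
  | WP v g => p v g | WS e => s e 1%g | WSt e => star (s e 1%g)
  | WM a b => wval a ** wval b
  end.

Lemma wval_star w : wval (wstar X w) = star (wval w).
Proof.
have [F _] := univL.
elim: w => //= [v g|e|a IHa b IHb].
- by rewrite (GE_family_star F).
- by rewrite starK.
- by rewrite starM IHa IHb.
Qed.

(** Combinations of words contain the generators, as $s_{e,g}=s_{e,e_G}\,p_{s(e),g}$, and are stable
    under all operations, since the star of a word is again a word. *)
Lemma word_span a : exists l : seq (R * word),
  a = \sum_(i <- l) i.1 *: wval i.2.
Proof.
have [F _] := univL.
elim/GE_algebra_ind: a => [v g|e g||a b [l ->] [m ->]|a [l ->]|k a [l ->]
  |a b [l ->] [m ->]|a [l ->]].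
- by exists [:: (1, WP v g)]; rewrite big_seq1 scale1r.
- exists [:: (1, WM (WS G e) (WP (src e) g))].
  rewrite big_seq1 scale1r /= (GE_family_SP F) mul1g.
  by rewrite vact1 eqxx.
- by exists [::]; rewrite big_nil.
- by exists (l ++ m); rewrite big_cat.
- exists [seq (- i.1, i.2) | i <- l]; rewrite big_map -sumrN.
  by apply: eq_bigr => i _; rewrite scaleNr.
- exists [seq (k * i.1, i.2) | i <- l]; rewrite big_map scaler_sumr.
  by apply: eq_bigr => i _; rewrite scalerA.
- exists [seq (i.1 * j.1, WM i.2 j.2) | i <- l, j <- m].
  rewrite big_allpairs_dep rngmul_suml; apply: eq_bigr => i _.
  rewrite rngmul_sumr; apply: eq_bigr => j _ /=.
  by rewrite -scale_rngmulAr -scale_rngmulAl scalerA mulrC.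
- exists [seq (rstar i.1, wstar X i.2) | i <- l]; rewrite big_map star_sum.
  by apply: eq_bigr => i _; rewrite starZ wval_star.
Qed.

Section Representation.
Variable Y : system X.

Definition rep : L -> op_pair R Y :=
  projT1 (cid (univL.2 _ _ _ (GE_family_rep R Y))).

Lemma rep_linear : linear rep.
Proof. by rewrite /rep; case: cid => h [[[]]]. Qed.

Lemma repM a b : rep (a ** b) = rep a ** rep b.
Proof. by rewrite /rep; case: cid => h [[[]]]. Qed.

Lemma rep_star a : rep (star a) = star (rep a).
Proof. by rewrite /rep; case: cid => h [[[]]]. Qed.

Lemma rep_P v g : rep (p v g) = repP R Y v g.
Proof. by rewrite /rep; case: cid => h [[]]. Qed.

Lemma rep_S e g : rep (s e g) = repS R Y e g.
Proof. by rewrite /rep; case: cid => h [[]]. Qed.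

Lemma repD a b : rep (a + b) = rep a + rep b.
Proof. by rewrite -[a]scale1r rep_linear !scale1r. Qed.

Lemma rep0 : rep 0 = 0.
Proof. by apply: (addrI (rep 0)); rewrite -repD !addr0. Qed.

Lemma repZ k a : rep (k *: a) = k *: rep a.
Proof. by rewrite -[k *: a]addr0 rep_linear rep0 addr0. Qed.

Lemma repN a : rep (- a) = - rep a.
Proof. by rewrite -scaleN1r repZ scaleN1r. Qed.

Lemma rep_wval w : rep (wval w) = opw R Y w.
Proof.
have rS e : rep (s e 1%g) = opw R Y (WS G e).
  rewrite rep_S; apply: opw_eq => y /=; case: eqP => //= h.
  by rewrite -h src_hd eqxx invg1 act1.
elim: w => //= [v g|e|a IHa b IHb].
- exact: rep_P.
- by rewrite rep_star rS opw_star.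
- by rewrite repM IHa IHb opwM.
Qed.

Lemma rep_sum (l : seq (R * word)) x y :
  fw (rep (\sum_(i <- l) i.1 *: wval i.2)) x y =
  \sum_(i <- l) i.1 * oapp x 0 (wact i.2 y).
Proof.
rewrite (big_morph _ repD rep0) fw_sum; apply: eq_bigr => i _.
by rewrite repZ rep_wval.
Qed.

End Representation.

Hypothesis simpleL : simple_ring L.

Lemma oner_neq0_simple : 1 != 0 :> R.
Proof.
have [[a a0] _] := simpleL; apply: contra_neq a0 => h.
by rewrite -[a]scale1r h scale0r.
Qed.

Lemma simple_ideal (I : set L) a b : two_sided_ideal I -> I a -> a <> 0 -> I b.
Proof.
move=> Iid Ia a0; have [_ /(_ _ Iid)[h|->//]] := simpleL.
by move: Ia; rewrite h.
Qed.

(** The elements with zero first component form a two-sided ideal. It misses the projection at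
    [base y0], which keeps the value 1 of the constant function at [y0], so by simplicity it is
    zero. *)
Lemma rep_faithful (Y : system X) (y0 : Y) a :
  (forall x y, fw (rep Y a) x y = 0) -> a = 0.
Proof.
move=> ha; apply: contrapT => a0.
pose I := [set b | forall x y, fw (rep Y b) x y = 0].
have Iid : two_sided_ideal I.
  split; first split.
  - by move=> x y; rewrite rep0.
  - by move=> b c hb hc x y; rewrite repD repN /= hb hc subr0.
  - by move=> b c hb x y; rewrite repM /= hb.
  - move=> b c hc x y; rewrite repM /=.
    have -> : fw (rep Y c) x = fun=> 0 by apply/funext => z; exact: hc.
    by apply: lin0; exact: fw_lin.
have := simple_ideal (p (base y0) 1%g) Iid ha a0.
move=> /(_ (fun=> 1) y0); rewrite rep_P /= /pull /= eqxx /= => /eqP.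
by rewrite (negbTE oner_neq0_simple).
Qed.

Lemma wval_wact (Y : system X) a b : wval a = wval b ->
  forall y : Y, wact a y = wact b y.
Proof.
move=> ab y.
have key x : oapp x 0 (wact a y) = oapp x 0 (wact b y) :> R.
  by have := congr1 (fun c => fw (rep Y c) x y) ab; rewrite !rep_wval.
pose d (z t : Y) : R := if `[< t = z >] then 1 else 0.
have dP z o : oapp (d z) 0 o = 1 -> o = Some z.
  case: o => [t|] /=; last by move/esym/eqP; rewrite (negbTE oner_neq0_simple).
  rewrite /d; case: asboolP => [->//|_ /esym /eqP].
  by rewrite (negbTE oner_neq0_simple).
have dz z : d z z = 1 by rewrite /d asboolT.
case ha: (wact a y) => [z|].
  by have := key (d z); rewrite ha /= dz => /esym /dP ->.
case hb: (wact b y) => [z|] //.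
by have := key (d z); rewrite hb /= dz => /dP; rewrite ha.
Qed.

(** Together with [wval_wact], this carries an identity of actions from any one nonempty system to
    all systems. *)
Lemma wact_wval (Y : system X) (y0 : Y) a b :
  (forall y : Y, wact a y = wact b y) -> wval a = wval b.
Proof.
move=> ab; apply/eqP; rewrite -subr_eq0; apply/eqP.
apply: (rep_faithful y0) => x y.
by rewrite repD repN !rep_wval (opw_eq _ ab) subrr.
Qed.

Lemma wact_wval0 (Y : system X) (y0 : Y) a :
  (forall y : Y, wact a y = None) -> wval a = 0.
Proof.
move=> h; apply: (rep_faithful y0) => x y.
by rewrite rep_wval opw0.
Qed.

(** The set $kL$ is a two-sided ideal; once it is nonzero, it is all of [L]. *)
Lemma simple_divisible (k : R) (a b : L) : k *: a <> 0 -> exists c, b = k *: c.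
Proof.
move=> ka; have Iid : two_sided_ideal [set b | exists c : L, b = k *: c].
  split; first split.
  - by exists 0; rewrite scaler0.
  - by move=> _ _ [c ->] [d ->]; exists (c - d); rewrite scalerBr.
  - by move=> _ d [c ->]; exists (c ** d); rewrite scale_rngmulAl.
  - by move=> d _ [c ->]; exists (d ** c); rewrite scale_rngmulAr.
by apply: (simple_ideal b Iid _ ka); exists a.
Qed.

End Universal.

(** * Infinite paths and germs *)

Section PathSystem.
Variables (G : groupType) (E : digraph) (X : self_similar_triple G E).
Variable H : vertex E -> Prop.
Hypothesis H_act : forall g v, H v -> H (vact X g v).
Hypothesis H_rng : forall e : edge E, H (src e) -> H (rng e).

(** The predicate [H] cuts out a system of infinite paths. Taking it always true gives all paths;
    later it also singles out the vertices that reach a given orbit. *)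
Definition is_ray (x : nat -> edge E) :=
  (forall n, src (x n) = rng (x n.+1)) /\ (forall n, H (rng (x n))).

Definition ray := {x : nat -> edge E | is_ray x}.

Lemma ray_ext (x y : ray) : (forall n, sval x n = sval y n) -> x = y.
Proof. by case: x y => x xr [y yr] /= h; apply: eq_exist; apply/funext. Qed.

Fixpoint seq_act n g (x : nat -> edge E) :=
  if n is n'.+1 then seq_act n' (coc X g (x 0)) (fun k => x k.+1)
  else eact X g (x 0).

Lemma rng_seq_act n g x : is_ray x -> rng (seq_act n g x) = vact X g (rng (x n)).
Proof.
elim: n g x => [|n IH] g x [xs xH] /=; first exact: rng_eact.
by rewrite IH ?vact_coc.
Qed.

Fact ray_act_subproof g (x : ray) : is_ray (fun n => seq_act n g (sval x)).
Proof.
case: x => x xr /=; split=> n; last by rewrite rng_seq_act //; apply: H_act; apply: xr.2.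
elim: n g x xr => [|n IH] g x xr /=.
  by rewrite src_eact rng_eact vact_coc xr.1.
by apply: IH; split=> k; [exact: xr.1 | exact: xr.2].
Qed.

Definition ray_act g x : ray := exist _ _ (ray_act_subproof g x).

Definition ray_hd (x : ray) := sval x 0.

Fact ray_tl_subproof (x : ray) : is_ray (fun n => sval x n.+1).
Proof. by case: x => x [x1 x2]. Qed.

Definition ray_tl x : ray := exist _ _ (ray_tl_subproof x).

Fact ray_act1 x : ray_act 1%g x = x.
Proof.
apply: ray_ext => n /=; elim: n (sval x) => [|n IH] y /=; first by rewrite eact1.
by rewrite coc1 IH.
Qed.

Fact ray_actM g h x : ray_act (g * h)%g x = ray_act g (ray_act h x).
Proof.
apply: ray_ext => n /=; elim: n g h (sval x) => [|n IH] g h y /=; first exact: eactM.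
by rewrite cocM IH.
Qed.

Fact ray_prepend e y : src e = rng (ray_hd y) ->
  exists z, ray_hd z = e /\ ray_tl z = y.
Proof.
move=> h; have zr : is_ray (fun n => if n is n'.+1 then sval y n' else e).
  split=> -[|n] //=; first exact: (svalP y).1.
    by apply: H_rng; rewrite h; exact: (svalP y).2.
  exact: (svalP y).2.
by exists (exist _ _ zr); split=> //; exact: ray_ext.
Qed.

Definition path_system : system X.
Proof.
apply: (@System _ _ X ray (fun x => rng (ray_hd x)) ray_act ray_hd ray_tl) => //.
- exact: ray_act1.
- exact: ray_actM.
- by move=> x; apply: (svalP x).1.
- move=> x y h k; apply: ray_ext => -[|n] //.
  exact: (congr1 (fun z => sval z n) k).
- exact: ray_prepend.
- by move=> g x; exact: ray_ext.
Defined.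

Lemma path_agree_eq (x y : path_system) : (forall n, agree n x y) -> x = y.
Proof.
move=> h; apply: ray_ext => n; have := h n.+1; move: (x) (y).
elim: n => [|n IH] x' y' [h1 h2] //; exact: IH _ _ h2.
Qed.

Lemma ray_exists v : H v -> (forall w, H w -> exists e, rng e = w /\ H (src e)) ->
  exists x : path_system, base x = v.
Proof.
move=> Hv next.
have [e0 [e0v He0]] := next _ Hv.
pose S := {e : edge E | H (src e)}.
have /choice[f fP] : forall e : S, exists f : S, rng (sval f) = src (sval e).
  by move=> [e He]; have [f [h k]] := next _ He; exists (exist _ f k).
pose x n := sval (iter n f (exist _ e0 He0)).
have xr : is_ray x.
  split=> n; first by rewrite /x /= fP.
  by apply: H_rng; exact: svalP (iter n f _).
by exists (exist _ _ xr).
Qed.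

End PathSystem.

Section GermSystem.
Variables (G : groupType) (E : digraph) (X : self_similar_triple G E).

Variable P : system X.

Definition ev_eq (f g : nat -> G) : bool :=
  `[< exists N, forall n, (N <= n)%N -> f n = g n >].

Lemma ev_eq_equiv : equiv_class_of ev_eq.
Proof.
split.
- by move=> f; apply/asboolP; exists 0%N.
- by move=> f g; apply/asboolP/asboolP => -[N h]; exists N => n /h.
- move=> f g h /asboolP[N hN] /asboolP[M hM]; apply/asboolP; exists (maxn N M) => n.
  by rewrite geq_max => /andP[/hN -> /hM].
Qed.
Canonical ev_eq_rel := EquivRelPack ev_eq_equiv.

Definition tail_class := {eq_quot ev_eq}%qT.
Definition tclass (f : nat -> G) : tail_class := (\pi_tail_class f)%qT.

Lemma tclass_eq f g : tclass f = tclass g <->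
  exists N, forall n, (N <= n)%N -> f n = g n.
Proof.
split; first by move/eqmodP/asboolP.
by move=> h; apply/eqmodP/asboolP.
Qed.

Lemma tclass_repr c : exists N, forall n, (N <= n)%N -> repr (tclass c) n = c n.
Proof. by apply/tclass_eq; rewrite /tclass reprK. Qed.

Definition tmul (k : nat -> G) (c : tail_class) : tail_class :=
  tclass (fun n => k n * repr c n)%g.

Lemma tmul_class k f : tmul k (tclass f) = tclass (fun n => k n * f n)%g.
Proof. by apply/tclass_eq; have [N h] := tclass_repr f; exists N => n /h ->. Qed.

Definition tshift (c : tail_class) : tail_class := tclass (fun n => repr c n.+1).

Lemma tshift_class f : tshift (tclass f) = tclass (fun n => f n.+1).
Proof.
apply/tclass_eq; have [N h] := tclass_repr f; exists N => n Nn.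
by apply: h; exact: leqW.
Qed.

(** The entry at index 0 is a filler that the class does not see. *)
Definition tunshift (c : tail_class) : tail_class := tclass (fun n => repr c n.-1).

Lemma tclassE (c : tail_class) : exists f, c = tclass f.
Proof. by exists (repr c); rewrite /tclass reprK. Qed.

Lemma tunshiftK : cancel tunshift tshift.
Proof. by move=> c; rewrite tshift_class /= /tclass reprK. Qed.

Lemma tshift_inj : injective tshift.
Proof.
move=> c d; have [f ->] := tclassE c; have [g ->] := tclassE d.
rewrite !tshift_class => /tclass_eq[N h]; apply/tclass_eq; exists N.+1 => -[|n] //.
exact: h.
Qed.

(* A germ of the action at an infinite path, recorded by the values of the
   cocycle along the path up to finitely many of them, and its degree. *)
Definition germ := (P * tail_class * int)%type.

Definition germ_act g (y : germ) : germ :=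
  (act g y.1.1, tmul (fun n => pcoc n g y.1.1) y.1.2, y.2).

(** The shift matches [pcoc n.+1 g y = pcoc n (coc X g (hd y)) (tl y)], which gives the
    compatibility of tails with the action. *)
Definition germ_tl (y : germ) : germ := (tl y.1.1, tshift y.1.2, y.2 - 1).

Definition germs : system X.
Proof.
apply: (@System _ _ X germ (fun y => base y.1.1) germ_act (fun y => hd y.1.1) germ_tl).
- move=> [[x c] d]; rewrite /germ_act /= act1; congr (_, _, _).
  have [f ->] := tclassE c; rewrite tmul_class; congr tclass; apply/funext => n.
  by rewrite pcoc1 mul1g.
- move=> g h [[x c] d]; rewrite /germ_act /= actM; congr (_, _, _).
  have [f ->] := tclassE c; rewrite !tmul_class; congr tclass; apply/funext => n.
  by rewrite pcocM mulgA.
- by move=> y; exact: rng_hd.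
- by move=> y; exact: src_hd.
- move=> [[x c] d] [[x' c'] d'] /= h [k /tshift_inj -> /addIr ->].
  by rewrite (hd_tl_inj h k).
- move=> e [[x c] d] /= h; have [z [h1 h2]] := prepend h.
  exists (z, tunshift c, d + 1); split=> //.
  by rewrite /germ_tl /= h2 tunshiftK addrK.
- by move=> g y; exact: hd_act.
- move=> g [[x c] d]; rewrite /germ_act /germ_tl /= tl_act; congr (_, _, _).
  by have [f ->] := tclassE c; rewrite tmul_class !tshift_class tmul_class.
Defined.

Definition gpath (y : germs) : P := y.1.1.
Definition deg (y : germs) : int := y.2.

Lemma gpath_agree n (y : germs) : agree n y (gpath y).
Proof. by elim: n y => //= n IH y; split=> //; exact: IH (germ_tl y). Qed.

Lemma gpath_lift (x : P) (y : germs) : exists y' : germs, gpath y' = x.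
Proof. by exists (x, y.1.2, 0). Qed.

Lemma gpath_tl (y : germs) : gpath (tl y) = tl (gpath y). Proof. by []. Qed.
Lemma gpath_cons e (y : germs) : src e = base y ->
  gpath (cons e y) = cons e (gpath y).
Proof.
move=> h; have h' : src e = base (gpath y) by [].
apply: hd_tl_inj; rewrite ?hd_cons -?gpath_tl ?tl_cons //.
exact: (hd_cons h).
Qed.

Lemma gpath_wact w (y : germs) :
  wact w (gpath y) = omap gpath (wact w y).
Proof.
have bE (z : germs) : base (gpath z) = base z by [].
elim: w y => [v g|e|e|a IHa b IHb] y; rewrite [wact _ y]/= [wact _ _]/=.
- by rewrite bE; case: eqP.
- by rewrite -[hd (gpath y)]/(@hd _ _ _ germs y); case: eqP.
- by rewrite bE; case: eqP => //= h; rewrite gpath_cons.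
- by rewrite IHa; case: (wact a y) => //= z; rewrite IHb.
Qed.

Lemma deg_act g (y : germs) : deg (act g y) = deg y. Proof. by []. Qed.

Lemma deg_tln n y : deg (tln n y) = deg y - n%:Z.
Proof.
elim: n y => [|n IH] y; first by rewrite subr0.
by rewrite IH /deg /= -addrA -opprD -intS.
Qed.

(** At a late index [N] a fixed germ gives $\varphi(g,y_1\cdots y_N)f(N)=f(N)$, and $f(N)$ cancels.
    So germs are fixed exactly through strongly fixed prefixes of their paths. *)
Lemma germ_fixed g (y : germs) : act g y = y <->
  exists n, agree n (act g y) y /\ pcoc n g y = 1%g.
Proof.
split=> [h|[n [h k]]]; last first.
  by apply: (agree_tln_inj h); rewrite tln_act k act1.
have pE n : pcoc n g (gpath y) = pcoc n g y by exact/esym/agree_pcoc/gpath_agree.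
case: (tclassE y.1.2) => f fE.
have : tmul (fun n => pcoc n g (gpath y)) y.1.2 = y.1.2.
  exact: (congr1 (fun z : germs => z.1.2) h).
rewrite fE tmul_class => /tclass_eq[N /(_ N (leqnn N))] k.
exists N; rewrite h; split; first exact: agree_refl.
by rewrite -pE; apply: (mulIg (f N)); rewrite k mul1g.
Qed.

End GermSystem.

(** * Strongly fixed paths and neighbourhoods of germs *)

Section StronglyFixed.
Variables (G : groupType) (E : digraph) (X : self_similar_triple G E).
Hypothesis fin_msf : forall (g : G) (v : vertex E),
  finite_set [set a : prepath E | minimal_strongly_fixed X g a /\ a.1 = v].

Lemma edges_act_prefix (Y : system X) n g (y : Y) :
  edges_act X g (prefix_of n y) = prefix_of n (act g y).
Proof. by elim: n g y => //= n IH g y; rewrite IH hd_act tl_act. Qed.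

Lemma path_coc_prefix (Y : system X) n g (y : Y) v :
  path_coc X g (v, prefix_of n y) = pcoc n g y.
Proof. by rewrite /path_coc /=; elim: n g y => //= n IH g y; rewrite IH. Qed.

Lemma strongly_fixed_prefix (Y : system X) n g (y : Y) :
  strongly_fixed X g (base y, prefix_of n y) <->
  agree n (act g y) y /\ pcoc n g y = 1%g.
Proof.
rewrite /strongly_fixed path_coc_prefix /path_act /= edges_act_prefix -base_act.
split=> -[h k]; split=> //.
  by case: h => h1 h2; exact: prefix_of_agree.
by rewrite (agree_base h) (agree_prefix_of h).
Qed.

Lemma is_path_prefix (Y : system X) n (y : Y) : is_path (base y, prefix_of n y).
Proof.
rewrite /is_path /=; case: n => //= n; rewrite rng_hd eqxx andbT.
elim: n y => //= n IH y; rewrite src_hd rng_hd eqxx /=; exact: IH.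
Qed.

Lemma prefix_of_take (Y : system X) m n (y : Y) :
  (m <= n)%N -> take m (prefix_of n y) = prefix_of m y.
Proof. by elim: m n y => [|m IH] [|n] y //= mn; rewrite IH. Qed.

Lemma size_prefix_of (Y : system X) n (y : Y) : size (prefix_of n y) = n.
Proof. by elim: n y => //= n IH y; rewrite IH. Qed.

(* N is the greatest length of a minimal strongly fixed path for g with range v. *)
Lemma strongly_fixed_bounded g v : exists N, forall (Y : system X) (y : Y) n,
  base y = v -> agree n (act g y) y -> pcoc n g y = 1%g ->
  exists2 m, (m <= N)%N & agree m (act g y) y /\ pcoc m g y = 1%g.
Proof.
have /finite_seqP[l lE] := fin_msf g v.
exists (\max_(a <- l) size a.2) => Y y n yv ag pc1.
have ex : exists n, `[< agree n (act g y) y /\ pcoc n g y = 1%g >].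
  by exists n; apply/asboolP.
(* For the least such [m] the prefix of length [m] is a minimal strongly fixed path, hence occurs in
   the finite list [l]. *)
case: (ex_minnP ex) => m /asboolP mP mmin; exists m => //.
rewrite -[m in (m <= _)%N](size_prefix_of m y).
suff ain : (base y, prefix_of m y) \in l.
  exact: (@leq_bigmax_seq _ _ _ (fun a : prepath E => size a.2) _ ain).
suff : [set` l] (base y, prefix_of m y) by [].
rewrite -lE; split=> //; split; first exact: is_path_prefix.
  by apply/strongly_fixed_prefix.
move=> k /= /prefixP[k' kE] kn sf.
have km : (size k <= m)%N by rewrite -(size_prefix_of m y) kE size_cat leq_addr.
have kp : k = prefix_of (size k) y by rewrite -(prefix_of_take y km) kE take_size_cat.
move: sf; rewrite [k in (_, k)]kp => /strongly_fixed_prefix /asboolP /mmin mk.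
have e : size k = m by apply/eqP; rewrite eqn_leq km.
by case/eqP: kn; rewrite kp e.
Qed.

(** A fixed germ near [y] has a strongly fixed prefix, and then one of length at most [N] by the
    finiteness hypothesis. It shares this prefix with [y], so [y] would be fixed as well. *)
Lemma germ_moved_open (P : system X) g (y : germs P) : act g y <> y ->
  exists N, forall y' : germs P, agree N y' y -> act g y' <> y'.
Proof.
move=> gy; have [N NP] := strongly_fixed_bounded g (base y).
exists N => y' y'y /germ_fixed[n [h k]].
have [|m mN [h' k']] := NP _ y' n _ h k; first exact: agree_base y'y.
have ym := agree_le mN y'y.
apply: gy; apply/germ_fixed; exists m; rewrite -(agree_pcoc g ym); split=> //.
apply: (agree_trans _ ym); apply: (agree_trans _ h').
by apply: agree_act; exact: agree_sym ym.
Qed.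

(* This lemma and the next one say that the fixed points of a word are a clopen
   set of germs, which expresses that the groupoid of germs is Hausdorff. *)
Lemma germ_wact_fixed (P : system X) w (y : germs P) : wact w y = Some y ->
  exists N, forall y' : germs P, agree N y' y -> wact w y' = Some y'.
Proof.
move=> wy; have [n [m [h nP]]] := wact_local wy.
have [z [E0 _ E1]] := nP y (agree_refl _ _).
move: E0; rewrite wy => -[E0]; subst z.
(* A fixed germ keeps its degree, so the word removes as many edges as it adds. Then [h] fixes the
   tail of [y], through a strongly fixed prefix of some length [j]. *)
have nm : n = m.
  have := congr1 (@deg _ _ _ P) E1; rewrite deg_act !deg_tln => /addrI /oppr_inj.
  by case.
subst m; have [j [jy jc]] := (germ_fixed _ _).1 (esym E1).
exists (n + j)%N => y' /agreeD[y1 y2]; have [z' [-> z'z Ez]] := nP _ y1.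
congr Some; have zy' : agree n z' y' := agree_trans z'z (agree_sym y1).
apply: (agree_tln_inj zy'); rewrite Ez; apply/esym/germ_fixed; exists j.
have : agree j (tln n z') (tln n y).
  rewrite -(actK h (tln n z')) -(actK h (tln n y)) -Ez -E1; exact: agree_act.
move=> tz; rewrite (agree_pcoc h tz); split=> //.
by rewrite -Ez; apply: (agree_trans y2 (agree_sym tz)).
Qed.

Lemma germ_wact_moved (P : system X) w (y : germs P) : wact w y <> Some y ->
  exists N, forall y' : germs P, agree N y' y -> wact w y' <> Some y'.
Proof.
case wy: (wact w y) => [z|]; last first.
  by move=> _; have [n nP] := wact_localN wy; exists n => y' /nP ->.
move=> zy; have {zy} zy : z <> y by move=> e; apply: zy; rewrite e.
have [n [m [h nP]]] := wact_local wy.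
have [z0 [E0 _ E1]] := nP y (agree_refl _ _).
move: E0; rewrite wy => -[E0]; subst z0.
(* The word changes the degree, or the first [n] edges, or [h] moves the tail. Each of these
   persists nearby, the last by [germ_moved_open]. *)
have [nm|nm] := eqVneq n m; last first.
  exists n => y' /nP[z' [-> _ Ez]] [e]; subst z'.
  have := congr1 (@deg _ _ _ P) Ez; rewrite deg_act !deg_tln => /addrI /oppr_inj.
  by case=> e; rewrite e eqxx in nm.
subst m.
have [zyn|zyn] := pselect (agree n z y); last first.
  exists n => y' y'y; have [z' [-> z'z _]] := nP _ y'y => -[e]; subst z'.
  by apply: zyn; apply: (agree_trans _ y'y); exact: agree_sym z'z.
have hm : act h (tln n y) <> tln n y.
  move=> e; apply: zy; apply: (agree_tln_inj zyn).
  by rewrite -(actK h (tln n z)) -E1 -{1}e actK.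
have [N NP] := germ_moved_open hm.
exists (n + N)%N => y' /agreeD[y1 y2]; have [z' [-> _ Ez]] := nP _ y1.
by case=> e; subst z'; apply: (NP _ y2).
Qed.

End StronglyFixed.

(** * Pure infiniteness *)

Section Cylinders.
Variables (G : groupType) (E : digraph) (X : self_similar_triple G E).

Lemma wactM (Y : system X) a b (y : Y) :
  wact (WM a b) y = obind (wact (Y := Y) b) (wact a y).
Proof. by []. Qed.

Lemma wact_vertex (Y : system X) (y : Y) v :
  base y = v -> wact (WP v 1%g) y = Some y.
Proof. by move=> /= ->; rewrite eqxx invg1 act1. Qed.

Lemma wact_range (Y : system X) w (y : Y) :
  wact (WM w (wstar X w)) y = if wact w y is Some _ then Some y else None.
Proof. by rewrite /=; case h: (wact w y) => [z|] //=; exact: wact_star. Qed.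

Lemma wact_source (Y : system X) w (z : Y) :
  wact (WM (wstar X w) w) z =
  if pselect (exists y : Y, wact w y = Some z) then Some z else None.
Proof.
rewrite /=; case h: (wact _ z) => [y|] /=.
  by have k := (wact_starE _ _ _).1 h; rewrite k; case: pselect => //= -[]; exists y.
by case: pselect => //= -[y /wact_star]; rewrite h.
Qed.

End Cylinders.

(** The terms are grouped by the value of [K]: each [z] has total coefficient 0, and [None]
    contributes the default 0. The type [{classic T}] supplies the equality test. *)
Lemma sum_by_value (R : comPzRingType) (I T : Type) (l : seq I) (F : I -> R)
    (K : I -> option T) (x : T -> R) :
  (forall z, \sum_(i <- l | `[< K i = Some z >]) F i = 0) ->
  \sum_(i <- l) F i * oapp x 0 (K i) = 0.
Proof.
move=> h; pose K' i : option {classic T} := K i.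
pose U := undup (map K' l).
transitivity (\sum_(i <- l) \sum_(k <- U | k == K' i) F i * oapp x 0 k).
  have : all (fun k => k \in U) (map K' l).
    by apply/allP => k; rewrite mem_undup.
  elim: (l) => [|i m IH] /=; first by rewrite !big_nil.
  move=> /andP[iU mU]; rewrite !big_cons IH //; congr (_ + _).
  rewrite big_mkcond (bigD1_seq _ iU (undup_uniq _)) /= eqxx big1 ?addr0 //.
  by move=> k /negbTE ->.
rewrite (exchange_big_dep xpredT) //= big1 // => k _.
rewrite -mulr_suml; case: k => [z|] /=; last by rewrite mulr0.
rewrite [X in X * _](_ : _ = 0) ?mul0r // -[RHS](h z).
apply: eq_bigl => i; rewrite /K'.
by apply/eqP/asboolP => [->|->].
Qed.

Lemma concat_path (G : groupType) (E : digraph) (X : self_similar_triple G E)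
    (Y : system X) (c : prepath E) (z : Y) : is_path c -> base z = path_src c ->
  exists x : Y, base x = c.1 /\ tln (size c.2) x = z.
Proof.
case: c => v l; rewrite /is_path /path_src /=.
elim: l v => [|e l IH] v /=; first by exists z.
move=> /andP[el /eqP ev] zl; have [|x [xe xz]] := IH (src e) _ zl.
  by case: (l) el => //= f m /andP[/eqP-> ->]; rewrite eqxx.
have ex := esym xe.
by exists (cons e x); rewrite base_cons // tl_cons.
Qed.

Section Main.
Variables (R : comStarRingType) (G : groupType) (E : digraph).
Variables (X : self_similar_triple G E) (L : starAlgType R).
Variables (p : vertex E -> G -> L) (s : edge E -> G -> L).
Hypothesis univL : is_universal_GE_algebra X p s.
Hypothesis fin_msf : forall (g : G) (v : vertex E),
  finite_set [set a : prepath E | minimal_strongly_fixed X g a /\ a.1 = v].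
Hypothesis simpleL : simple_ring L.

Local Notation word := (word G E).
Local Notation wval := (wval p s).

Variable v0 : vertex E.

Variable paths : system X.
Hypothesis paths_exist : forall v, exists x : paths, base x = v.
Hypothesis paths_separated : forall x y : paths, (forall n, agree n x y) -> x = y.

(** * Compression to cylinders of paths *)

Definition fixes_cylinder w n (x : paths) :=
  forall y : paths, agree n y x -> wact w y = Some y.

Definition moves_cylinder w n (x : paths) :=
  forall y z : paths, agree n y x -> wact w y = Some z -> ~ agree n z x.

Lemma fixes_cylinder_sub w m n (x y : paths) : (m <= n)%N -> agree m y x ->
  fixes_cylinder w m x -> fixes_cylinder w n y.
Proof.
move=> mn yx fx z zy; apply: fx.
exact: agree_trans (agree_le mn zy) yx.
Qed.

Lemma moves_cylinder_sub w m n (x y : paths) : (m <= n)%N -> agree m y x ->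
  moves_cylinder w m x -> moves_cylinder w n y.
Proof.
move=> mn yx fx z t zy wz ty; apply: (fx z t) => //.
  exact: agree_trans (agree_le mn zy) yx.
exact: agree_trans (agree_le mn ty) yx.
Qed.

Lemma eq_wval a b : (forall y : paths, wact a y = wact b y) -> wval a = wval b.
Proof. by have [y0 _] := paths_exist v0; exact: (wact_wval univL simpleL y0). Qed.

Lemma wval0 a : (forall y : paths, wact a y = None) -> wval a = 0.
Proof. by have [y0 _] := paths_exist v0; exact: (wact_wval0 univL simpleL y0). Qed.

(** The compressed word puts the first [n] edges of [x] in front of a path, applies [w], which does
    nothing there, and removes the edges again. *)
Lemma fixes_cylinder_compress w n (x : paths) : fixes_cylinder w n x ->
  wval (WM (wstar X (wpath n x)) (WM w (wpath n x))) = p (base (tln n x)) 1%g.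
Proof.
move=> fx; rewrite -[RHS]/(wval (WP (base (tln n x)) 1%g)); apply: eq_wval => z /=.
rewrite invg1 act1; case h: (wact (wstar _ _) z) => [y|] /=.
  have [yx yz] := (wact_path_starP _ _ _ _).1 h.
  rewrite fx //= wact_path; case: pselect => //= _; rewrite yz.
  have /agreeD[_ /agree_base] : agree (n + 0) y x by rewrite addn0.
  by rewrite yz => ->; rewrite eqxx.
by move/wact_path_starN: h; case: eqP.
Qed.

(** Once the edges are in front, [w] is undefined or leaves the cylinder, so they cannot be removed
    again. *)
Lemma moves_cylinder_compress w n (x : paths) : moves_cylinder w n x ->
  wval (WM (wstar X (wpath n x)) (WM w (wpath n x))) = 0.
Proof.
move=> mx; apply: wval0 => z /=; case h: (wact (wstar _ _) z) => [y|] //=.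
have [yx yz] := (wact_path_starP _ _ _ _).1 h.
case k: (wact w y) => [t|] //=; rewrite wact_path; case: pselect => //= tx.
by case: (mx y t).
Qed.

(** Neighbourhoods of germs only look at the underlying paths, so each path of the cylinder lifts to
    a germ near [y], which [germ_wact_fixed] shows to be fixed. *)
Lemma germ_fixes_cylinder w (y : germs paths) : wact w y = Some y ->
  exists N, forall x : paths, agree N x y -> fixes_cylinder w N x.
Proof.
move=> /(germ_wact_fixed) [N NP]; exists N => x xy z zx.
have [y' y'z] := gpath_lift z y.
have y'y : agree N y' y.
  apply: agree_trans (gpath_agree N y') _; rewrite y'z.
  exact: agree_trans zx xy.
by rewrite -y'z gpath_wact NP.
Qed.

(* If the word fixed every path in a cylinder, it would agree there with an
   idempotent in L, hence also on germs. *)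
Lemma germ_moves_cylinder w (y : germs paths) : wact w y <> Some y ->
  exists N, forall x : paths, agree N x y -> forall n0,
    exists2 x' : paths, agree n0 x' x &
      exists2 n, (n0 <= n)%N & moves_cylinder w n x'.
Proof.
move=> /(germ_wact_moved fin_msf)[N NP]; exists N => x xy n0.
pose n1 := maxn n0 N.
have [z [zx wz]] : exists z : paths, agree n1 z x /\ wact w z <> Some z.
  apply: contrapT => nz.
  have fx (z : paths) : agree n1 z x -> wact w z = Some z.
    by move=> zx; apply: contrapT => wz; apply: nz; exists z.
  pose Q := WM (wpath n1 x) (wstar X (wpath n1 x)).
  have QE : wval (WM Q w) = wval Q.
    apply: eq_wval => z; rewrite wactM wact_range wact_path.
    by case: pselect => //= zx; exact: fx.
  have [y1 y1x] := gpath_lift x y.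
  have y1a : agree n1 y1 x by rewrite -y1x; exact: gpath_agree.
  have := wval_wact univL simpleL QE y1.
  rewrite wactM wact_range wact_path.
  case: pselect => //= _; apply: NP; apply: (agree_trans _ xy).
  by apply: agree_le y1a; rewrite leq_maxr.
exists z; first by apply: agree_le zx; rewrite leq_maxl.
case wzE: (wact w z) => [t|]; last first.
  have [n nP] := wact_localN wzE; exists (maxn n n0); first by rewrite leq_maxr.
  by move=> a b /(agree_le (leq_maxl _ _)) /nP ->.
have [k kP] : exists k, ~ agree k t z.
  apply: contrapT => nk; apply: wz; rewrite wzE; congr Some.
  by apply: paths_separated => k; apply: contrapT => h; apply: nk; exists k.
have [n nP] := wact_continuous k wzE.
exists (maxn (maxn n k) n0); first by rewrite leq_maxr.
move=> a b az wa bz.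
have := nP a; case.
  by apply: agree_le az; rewrite !leq_max leqnn.
move=> b'; rewrite wa => -[<-] bt; apply: kP.
apply: agree_trans (agree_sym bt) _.
by apply: agree_le bz; rewrite !leq_max leqnn orbT.
Qed.

(** On a small enough cylinder near [y], words fixing [y] compress to the vertex projection and the
    others to 0. The words are treated one at a time in ever smaller cylinders, for which the free
    bound [n0] makes room. *)
Lemma separate_germ (l : seq (R * word)) (y : germs paths) :
  exists N, forall x : paths, agree N x y -> forall n0,
    exists2 x' : paths, agree n0 x' x & exists2 n, (n0 <= n)%N &
      wval (wstar X (wpath n x')) ** (\sum_(i <- l) i.1 *: wval i.2) **
        wval (wpath n x') =
      (\sum_(i <- l | `[< wact i.2 y = Some y >]) i.1) *: p (base (tln n x')) 1%g.
Proof.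
pose good w n (x : paths) :=
  if `[< wact w y = Some y >] then fixes_cylinder w n x else moves_cylinder w n x.
have good_sub w m n (x z : paths) : (m <= n)%N -> agree m z x -> good w m x -> good w n z.
  rewrite /good; case: asboolP => _ mn zx.
    exact: fixes_cylinder_sub.
  exact: moves_cylinder_sub.
suff [N NP] : exists N, forall x : paths, agree N x y -> forall n0,
    exists2 x' : paths, agree n0 x' x & exists2 n, (n0 <= n)%N &
      foldr (fun i P => good i.2 n x' /\ P) True l.
  exists N => x xy n0; have [x' x'x [n n0n gd]] := NP x xy n0.
  exists x' => //; exists n => //.
  rewrite rngmul_sumr rngmul_suml [in RHS]big_mkcond scaler_suml.
  elim: l gd {NP} => [|i l IH] /=; first by rewrite !big_nil.
  move=> [gi /IH {}IH]; rewrite !big_cons IH; congr (_ + _).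
  rewrite -scale_rngmulAr -scale_rngmulAl -rngmulA.
  move: gi; rewrite /good; case: asboolP => _ gi.
    by rewrite -(fixes_cylinder_compress gi).
  by rewrite scale0r -[X in _ *: X]/(wval (WM (wstar X (wpath n x'))
    (WM i.2 (wpath n x')))) (moves_cylinder_compress gi) scaler0.
elim: l => [|[c w] l [N NP]].
  by exists 0%N => x _ n0; exists x; [exact: agree_refl | exists n0].
have [M MP] : exists M, forall x : paths, agree M x y -> forall n0,
    exists2 x' : paths, agree n0 x' x & exists2 n, (n0 <= n)%N & good w n x'.
  rewrite /good; case: asboolP => [/germ_fixes_cylinder[M MP]|].
    exists M => x xy n0; exists x; first exact: agree_refl.
    exists (maxn M n0); first by rewrite leq_maxr.
    by apply: (fixes_cylinder_sub (leq_maxl _ _) (agree_refl _ _)); exact: MP.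
  exact: germ_moves_cylinder.
exists (maxn N M) => x xy n0.
have [x1 x1x [n1 n1n g1]] := NP x (agree_le (leq_maxl _ _) xy) (maxn n0 M).
have [|x2 x2x [n2 n2n g2]] := MP x1 _ n1.
  apply: agree_trans (agree_le (leq_maxr _ _) x1x) _.
  exact: agree_le (leq_maxr _ _) xy.
exists x2.
  apply: agree_trans (agree_le _ x2x) (agree_le (leq_maxl _ _) x1x).
  by apply: leq_trans n1n; rewrite leq_maxl.
exists n2; first by apply: leq_trans n2n; apply: leq_trans n1n; rewrite leq_maxl.
split=> //; elim: (l) g1 => //= i m IH [gi /IH gm]; split=> //.
exact: good_sub gi.
Qed.

Lemma scale_P_neq0 (r : R) u : r != 0 -> r *: p u 1%g <> 0.
Proof.
move=> r0 h; case/eqP: r0; have [y yu] := paths_exist u.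
have := congr1 (fun a => fw (rep univL paths a) (fun=> 1) y) h.
by rewrite repZ rep0 rep_P /= /pull /= yu eqxx /= mulr1.
Qed.

Lemma compress_to_vertex a : a <> 0 -> exists x y u, x ** a ** y = p u 1%g.
Proof.
move=> a0; have [l aE] := word_span univL a.
have [x0 _] := paths_exist v0.
(* As [a] is nonzero it acts nontrivially on germs; by [sum_by_value], for some [y] and [z] the
   coefficients of the words taking [y] to [z] do not cancel. *)
have [y [z rn0]] : exists (y z : germs paths),
    \sum_(i <- l | `[< wact i.2 y = Some z >]) i.1 != 0.
  apply: contrapT => h; apply: a0.
  have y0 : germs paths := (x0, tclass (fun=> 1%g), 0).
  apply: (@rep_faithful _ _ _ _ _ _ _ univL simpleL (germs paths) y0) => f y.
  rewrite aE rep_sum.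
  apply: sum_by_value => z; apply/eqP; apply: contrapT => /negP k.
  by apply: h; exists y, z.
have [W WE] : exists W, wact W y = Some z.
  apply: contrapT => h; case/eqP: rn0; rewrite big_pred0 // => i.
  by apply/asboolP => k; apply: h; exists i.2.
(* Multiplying by $W^*$ on the right turns the words that take [y] to [z] into words that fix
   [y]. *)
pose l' := [seq (i.1, WM i.2 (wstar X W)) | i <- l].
have [N NP] := separate_germ l' y.
have [x _ [n _]] := NP (gpath y) (agree_sym (gpath_agree _ _)) 0%N.
have -> : \sum_(i <- l') i.1 *: wval i.2 = a ** wval (wstar X W).
  rewrite aE rngmul_suml big_map; apply: eq_bigr => i _ /=.
  by rewrite scale_rngmulAl.
rewrite big_map (eq_bigl (fun i => `[< wact i.2 y = Some z >])); last first.
  move=> i /=; apply/asboolP/asboolP; last by move=> -> /=; exact: (wact_star WE).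
  case: (wact i.2 y) => [t|] //= k.
  by have := (@wact_starE _ _ _ (germs paths) _ _ _).1 k; rewrite WE => ->.
set r := \sum_(i <- l | _) _; set u := base _; move=> E1.
(* With $p_u=rb$ one has $p_u=p_up_u=(rp_u)b$, and $rp_u$ is the compressed element. *)
have [b bE] := simple_divisible simpleL (p u 1%g) (scale_P_neq0 (u := u) rn0).
have ppE : p u 1%g ** p u 1%g = p u 1%g.
  by rewrite (GE_family_PP univL.1) vact1 eqxx mulg1.
exists (wval (wstar X (wpath n x))), (wval (wstar X W) ** wval (wpath n x) ** b), u.
rewrite -[RHS]ppE [X in _ = _ ** X]bE -scale_rngmulAr scale_rngmulAl -E1.
by rewrite !rngmulA.
Qed.

(* For the initial segment x_1 ... x_n of a path and h such that its source is
   h.v, this is the partial isometry S_{x_1 ... x_n} P_{h.v, h}. *)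
Definition corner n (x : paths) h : word :=
  WM (wpath n x) (WP (base (tln n x)) h).

Arguments corner : simpl never.

Lemma wact_corner (Y : system X) n (x : paths) h (y : Y) :
  wact (corner n x h) y =
  if pselect (agree n y x) then Some (act h^-1%g (tln n y)) else None.
Proof.
rewrite wactM wact_path; case: pselect => //= yx.
have /agreeD[_ /agree_base ->] : agree (n + 0) y x by rewrite addn0.
by rewrite eqxx.
Qed.

Lemma corner_source n (x : paths) h v : base (tln n x) = vact X h v ->
  wval (wstar X (corner n x h)) ** wval (corner n x h) = p v 1%g.
Proof.
move=> xv; rewrite -[RHS]/(wval (WP v 1%g)).
rewrite -[LHS]/(wval (WM (wstar X (corner n x h)) (corner n x h))).
apply: eq_wval => z; rewrite wact_source [RHS]/= invg1 act1.
case: pselect => [[y yz]|h1] /=; case: eqP => //= h2.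
  move: yz; rewrite wact_corner; case: pselect => //= yx [zE]; case: h2.
  rewrite -zE base_act.
  have /agreeD[_ /agree_base ->] : agree (n + 0) y x by rewrite addn0.
  by rewrite xv -vactM mulVg vact1.
have [|y [yx yz]] := @agree_concat _ _ _ paths paths n x (act h z).
  by rewrite base_act h2.
case: h1; exists y; rewrite wact_corner; case: pselect => //= _.
by rewrite yz actK.
Qed.

Lemma P_corner n (x : paths) h :
  p (base x) 1%g ** wval (corner n x h) = wval (corner n x h).
Proof.
rewrite -[LHS]/(wval (WM (WP (base x) 1%g) (corner n x h))).
apply: eq_wval => y; rewrite wactM [wact (WP _ _) y]/= invg1 act1.
case: eqP => yx //; rewrite [LHS]/= wact_corner.
by case: pselect => //= /agree_base k; case: yx.
Qed.

(* If the range of the partial isometry of a circuit were all of P_v, then only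
   one path would start at v; the circuit would act on it as the identity, and
   so equal P_v, although it has nonzero degree. *)
Lemma circuit_infinite n g (x : paths) :
  (0 < n)%N -> base (tln n x) = vact X g (base x) ->
  infinite_idempotent (p (base x) 1%g).
Proof.
move=> n0 xg; set v := base x; pose t := corner n x g.
have tt : wval (wstar X t) ** wval t = p v 1%g := corner_source xg.
have pt : p v 1%g ** wval t = wval t := P_corner n x g.
have pp : p v 1%g ** p v 1%g = p v 1%g.
  by rewrite (GE_family_PP univL.1) vact1 eqxx mulg1.
have pS : star (p v 1%g) = p v 1%g.
  by rewrite (GE_family_star univL.1) invg1 vact1.
have tp : wval (wstar X t) ** p v 1%g = wval (wstar X t).
  by rewrite (wval_star univL) -{1}pS -starM pt.
have ptE : wval t ** p v 1%g = wval t.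
  rewrite -[LHS]/(wval (WM t (WP v 1%g))); apply: eq_wval => y.
  rewrite wactM wact_corner; case: pselect => //= yx.
  have /agreeD[_ /agree_base k] : agree (n + 0) y x by rewrite addn0.
  by rewrite base_act k xg -vactM mulVg vact1 eqxx invg1 act1.
split; first exact: pp.
exists (wval (wstar X t)), (wval t), (wval t ** wval (wstar X t)); split=> //.
- by rewrite /idempotent_elt rngmulA -(rngmulA (wval t)) tt ptE.
- move=> q.
  have cyl (y : paths) : base y = v -> agree n y x.
    move=> yv; have e : wval (WM t (wstar X t)) = wval (WP v 1%g) := q.
    have := wval_wact univL simpleL e y.
    rewrite wact_range wact_corner [RHS]/= yv eqxx.
    by case: pselect.
  (* Removing the [n] common edges and applying $g^{-1}$ leads back to paths with range [v], with
     only $k-n$ edges left to compare. *)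
  have uniq k (y z : paths) : base y = v -> base z = v -> agree k y z.
    elim/ltn_ind: k y z => k IH y z yv zv.
    have [kn|nk] := leqP k n.
      by apply: agree_le kn _; apply: agree_trans (cyl _ yv) (agree_sym (cyl _ zv)).
    rewrite -(subnKC (ltnW nk)); apply/agreeD; split.
      by apply: agree_trans (cyl _ yv) (agree_sym (cyl _ zv)).
    have tb (w : paths) : base w = v -> base (act g^-1%g (tln n w)) = v.
      move=> wv; rewrite base_act.
      have /agreeD[_ /agree_base ->] : agree (n + 0) w x by rewrite addn0; exact: cyl.
      by rewrite xg -vactM mulVg vact1.
    rewrite -(actVK g (tln n y)) -(actVK g (tln n z)); apply: agree_act.
    by apply: IH; [rewrite ltn_subrL n0 (leq_trans _ nk) | exact: tb | exact: tb].
  have tE : wval t = wval (WP v 1%g).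
    apply: eq_wval => y; rewrite wact_corner [RHS]/= invg1 act1.
    case: pselect => [yx|yx]; case: eqP => // yv; last by case: yx; exact: cyl.
      congr Some; apply: paths_separated => k; apply: uniq => //.
      rewrite base_act.
      have /agreeD[_ /agree_base ->] : agree (n + 0) y x by rewrite addn0.
      by rewrite xg -vactM mulVg vact1.
    by case: yv; rewrite (agree_base yx).
  have y0 : germs paths := (x, tclass (fun=> 1%g), 0).
  have [y yx] := gpath_lift x y0.
  have yv : base y = v by rewrite -[base y]/(base (gpath y)) yx.
  have : wact t y = Some y.
    by rewrite (wval_wact univL simpleL tE y) wact_vertex.
  rewrite wact_corner; case: pselect => [_|//] /Some_inj.
  move=> /(congr1 (@deg _ _ _ paths)).
  rewrite !deg_act deg_tln => /eqP; rewrite -subr_eq0 addrAC subrr sub0r oppr_eq0.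
  by rewrite eqz_nat -leqn0 leqNgt n0.
- by rewrite -rngmulA tp rngmulA pt.
Qed.

(* The paths all of whose vertices reach the orbit of v form a system; since it
   is faithful as well, every vertex reaches that orbit. *)
Lemma circuit_reached n g (x : paths) :
  (0 < n)%N -> base (tln n x) = vact X g (base x) ->
  forall u, exists (y : paths) m h,
    base y = u /\ base (tln m y) = vact X h (base x).
Proof.
move=> n0 xg; set v := base x.
pose H u := exists (y : paths) m h, base y = u /\ base (tln m y) = vact X h v.
have H_act k u : H u -> H (vact X k u).
  move=> [y [m [h [<- yh]]]]; exists (act k y), m, (pcoc m k y * h)%g.
  by rewrite base_act tln_act base_act yh vactM.
have H_rng (e : edge E) : H (src e) -> H (rng e).
  move=> [y [m [h [yu yh]]]]; exists (cons e y), m.+1, h.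
  by rewrite base_cons //= tl_cons.
(* If [u] already lies in the orbit, the translate of the circuit by [h] starts at [u] and returns
   to the orbit after [n] edges, so there is a first edge to follow. *)
have H_pos u : H u -> exists (y : paths) m h,
    base y = u /\ base (tln m.+1 y) = vact X h v.
  move=> [y [[|m] [h [yu yh]]]]; last by exists y, m, h.
  exists (act h x), n.-1, (pcoc n h x * g)%g; rewrite prednK //.
  split; first by rewrite base_act -yu -yh.
  by rewrite tln_act base_act xg vactM.
have Hv : H v by exists x, 0%N, 1%g; rewrite vact1.
have [|z zv] := ray_exists H_act H_rng Hv.
  move=> w /H_pos[y [m [h [<- yh]]]]; exists (hd y); rewrite rng_hd; split=> //.
  by rewrite src_hd; exists (tl y), m, h.
move=> u; apply: contrapT => Hu; apply: (@scale_P_neq0 1 u).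
  exact: oner_neq0_simple simpleL.
rewrite scale1r.
apply: (@rep_faithful _ _ _ _ _ _ _ univL simpleL (path_system H_act H_rng) z).
move=> f y.
rewrite rep_P /= /pull; case: eqP => //= yu; case: Hu.
by rewrite -yu; case: y {yu} => y' [y1 y2]; exact: y2.
Qed.

End Main.

(** Since $ba=P$, the map $z\mapsto azb$ is multiplicative on $PAP$ and carries witnesses for [P] to
    witnesses for $ab$. *)
Lemma infinite_idempotent_equiv (A : rngType) (P a b : A) :
  infinite_idempotent P -> b ** a = P -> a ** P = a -> P ** b = b ->
  infinite_idempotent (a ** b).
Proof.
move=> [PP [x [y [q [qq qP [Pq qp] xy yx]]]]] ba aP Pb.
have K (u v w : A) : u ** v = w -> forall z, z ** u ** v = z ** w.
  by move=> <- z; rewrite rngmulA.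
have [[PPK qqK] PqK] := (K _ _ _ PP, K _ _ _ qq, K _ _ _ Pq).
have [[qPK xyK] yxK] := (K _ _ _ qp, K _ _ _ xy, K _ _ _ yx).
have [baK PbK] := (K _ _ _ ba, K _ _ _ Pb).
split; first by rewrite /idempotent_elt !rngmulA baK aP.
(* Cutting down by [P] and [q] keeps the relations and makes the witnesses absorb [P] on the
   right. *)
pose x1 := P ** x ** q; pose y1 := q ** y ** P.
have xy1 : x1 ** y1 = P.
  by rewrite /x1 /y1 !rngmulA qqK -yx !rngmulA !xyK !PP.
have yx1 : y1 ** x1 = q.
  by rewrite /x1 /y1 !rngmulA PPK -xy !rngmulA !yxK !qq.
have x1P : x1 ** P = x1 by rewrite /x1 qPK.
have y1P : y1 ** P = y1 by rewrite /y1 PPK.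
have [xyK1 yxK1] := (K _ _ _ xy1, K _ _ _ yx1).
have [xPK yPK] := (K _ _ _ x1P, K _ _ _ y1P).
clearbody x1 y1.
exists (a ** x1 ** b), (a ** y1 ** b), (a ** q ** b); split.
- by rewrite /idempotent_elt !rngmulA baK qPK qqK.
- by move=> /(congr1 (fun z => b ** z ** a)); rewrite !rngmulA !baK ba Pq qp PP => /qP.
- by split; rewrite !rngmulA baK ?aP ?qPK.
- by rewrite !rngmulA baK xPK xyK1 aP.
- by rewrite !rngmulA baK yPK yxK1.
Qed.

Theorem proposition3p15 (R : comStarRingType) (G : groupType) (E : digraph)
    (X : self_similar_triple G E) (L : starAlgType R)
    (p : vertex E -> G -> L) (s : edge E -> G -> L)
    (univL : is_universal_GE_algebra X p s)
    (fin_msf : forall (g : G) (v : vertex E),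
      finite_set [set a : prepath E | minimal_strongly_fixed X g a /\ a.1 = v])
    (simpleL : simple_ring L)
    (circuit : exists (g : G) (c : prepath E), G_circuit X g c) :
  purely_infinite_simple L.
Proof.
pose paths : system X :=
  path_system (H := fun=> True) (fun _ _ _ => I) (fun _ _ => I).
have ex v : exists x : paths, base x = v.
  apply: ray_exists => // w _.
  by have [e ew] := sst_no_sources X w; exists e.
have sep (x y : paths) : (forall n, agree n x y) -> x = y by exact: path_agree_eq.
have [n [x [g [n0 xg]]]] : exists n (x : paths) g, (0 < n)%N /\
    base (tln n x) = vact X g (base x).
  have [g [[v l] [lp l0 lg]]] := circuit; have [z zl] := ex (path_src (v, l)).
  have [x [xv xz]] := concat_path lp zl.
  exists (size l), x, g; split=> //; rewrite xz zl lg; congr vact; exact: esym.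
have Pinf := circuit_infinite univL simpleL (base x) ex sep n0 xg.
split=> // I [I0 IB IM] Ine.
have [a Ia a0] : exists2 a, I a & a <> 0.
  apply: contrapT => h; apply: Ine; apply/seteqP; split=> [a Ia|a ->//].
  by apply: contrapT => a0; apply: h; exists a.
have [b [c [u bacE]]] :=
  compress_to_vertex univL fin_msf simpleL (base x) ex sep a0.
have [y [m [h [yu yh]]]] := circuit_reached univL simpleL ex n0 xg u.
have tt := corner_source univL simpleL (base x) ex yh.
have := P_corner univL simpleL (base x) ex m y h; rewrite yu => pt.
move: tt pt Pinf; move: (p (base x) 1%g) (wval p s (wstar X (corner m y h))).
move: (wval p s (corner m y h)).
move=> t P t' tt pt Pinf; have PP : P ** P = P := Pinf.1.
(* Here $t'(bac)t=t'p_ut=t't=P$, so [P] factors through [a]. *)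
have baP : t' ** b ** (a ** c ** t) = P.
  by rewrite -tt -{2}pt -bacE !rngmulA.
(* The element starts with [a], so it lies in [I]. It is $\alpha\beta$ with $\alpha=actP$,
   $\beta=Pt'b$ and $\beta\alpha=P$. *)
exists (a ** c ** t ** P ** (P ** (t' ** b))).
  by rewrite -!rngmulA; exact: IM.
apply: (infinite_idempotent_equiv Pinf).
- by rewrite -(rngmulA P) (rngmulA (t' ** b)) baP !PP.
- by rewrite -rngmulA PP.
- by rewrite rngmulA PP.
Qed.
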